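(* Let $m,n$ be positive integers, let $b<n$ and $r$ be non-negative integers, and suppose that $m\ge r-b+1$ and $n\ge r+1$. (i) If $(mn-r,r)$ is a partition, then $p\bigl((n-b,1^b),(m),(mn-r,r)\bigr)=|\mathscr{MP}^\star_b(r)|$. (ii) If $(mn-r,1^r)$ is a partition, then $p\bigl((n-b,1^b),(m),(mn-r,1^r)\bigr)=[r=b]$.
   Context: For partitions $\nu\vdash n$, $\mu\vdash m$, $\lambda\vdash mn$, the plethysm coefficient $p(\nu,\mu,\lambda)=\langle s_\nu\circ s_\mu,s_\lambda\rangle$ is the multiplicity of the Schur function $s_\lambda$ in the plethysm $s_\nu\circ s_\mu$. $\mathscr{MP}^\star_b(r)$ is the set of pairs of partitions $(\gamma,\epsilon)$ with $|\gamma|+|\epsilon|=r$ such that $\gamma$ has exactly $b$ parts, the parts of $\gamma$ are distinct, and all parts of $\epsilon$ are at least $2$. $[r=b]$ is $1$ if $r=b$ and $0$ otherwise. *)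

(* Defs.v *)
From Stdlib Require Import ClassicalEpsilon.
From mathcomp Require Import all_boot all_order all_algebra.
From mathcomp Require Import mpoly.

Set Implicit Arguments.
Unset Strict Implicit.
Unset Printing Implicit Defensive.

Import GRing.Theory.
Local Open Scope ring_scope.

(* Trailing zeros are allowed: (a, 0) and (a) denote the same partition. *)
Definition is_partition (s : seq nat) : bool := sorted geq s.

Definition strip (s : seq nat) : seq nat := [seq i <- s | (0 < i)%N].

(* All partitions of d, each as the sequence of its positive parts.  A         *)
(* partition of d has at most d parts, each at most d, so it is obtained from  *)
(* exactly one weakly decreasing d-tuple padded with zeros; see                *)
(* mem_partitions and partitions_uniq.                                         *)
Definition partitions (d : nat) : seq (seq nat) :=
  [seq strip (map val t)
     | t : d.-tuple 'I_d.+1 <- enum {: d.-tuple 'I_d.+1}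
         & is_partition (map val t) && (sumn (map val t) == d)].

Definition MPstar (b r : nat) : seq (seq nat * seq nat) :=
  [seq ge <- flatten [seq [seq (g, e) | g <- partitions k,
                                        e <- partitions (r - k)]
                       | k <- iota 0 r.+1]
     | [&& size ge.1 == b, uniq ge.1 & all (leq 2) ge.2]].

(* A symmetric function f, given by its restrictions f(x_0, .., x_{N-1}) for   *)
(* all N.                                                                      *)
Definition symfun := forall N : nat, {mpoly int[N]}.

(* tag c is the row and tagged c the column of the cell c. *)
Definition cell (la : seq nat) : finType :=
  {i : 'I_(size la) & 'I_(nth 0%N la i)}.

Definition semistandard (la : seq nat) (N : nat)
    (T : {ffun cell la -> 'I_N}) : bool :=
  [forall c : cell la, forall c' : cell la,
     ((tag c == tag c') && (tagged c <= tagged c')%N ==> (T c <= T c')%N)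
     && ((tagged c == tagged c' :> nat) && (tag c < tag c')%N
         ==> (T c < T c')%N)].

Definition schur (la : seq nat) : symfun := fun N =>
  \sum_(T : {ffun cell la -> 'I_N} | semistandard T)
     \prod_(c : cell la) 'X_(T c).

(* The monomials of g, repeated according to their coefficients, which are     *)
(* meant to be nonnegative.                                                    *)
Definition monomials (N : nat) (g : {mpoly int[N]}) : seq 'X_{1..N} :=
  flatten [seq nseq `|g@_w|%N w | w <- msupp g].

(* f o g: the monomials of g, with multiplicity, are substituted for the       *)
(* variables of f.  Their order is irrelevant since f is symmetric.            *)
Definition plethysm (f g : symfun) : symfun := fun N =>
  f (size (monomials (g N)))
    \mPo map_tuple (fun w => 'X_[w]) (in_tuple (monomials (g N))).

Definition schur_expansion (d : nat) (f : symfun) (c : seq nat -> int) : Prop :=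
  forall N : nat, f N = \sum_(la <- partitions d) c la *: schur la N.

(* < f, s_la > for f homogeneous of degree d and la a partition of d.  The     *)
(* Schur functions s_la, for la a partition of d, form a Z-basis of the        *)
(* symmetric functions of degree d, so c is determined on partitions d.        *)
Definition schur_coef (d : nat) (f : symfun) (la : seq nat) : int :=
  epsilon (inhabits (fun=> 0)) (schur_expansion d f) (strip la).

Definition plethysm_coef (nu mu la : seq nat) : int :=
  schur_coef (sumn nu * sumn mu) (plethysm (schur nu) (schur mu)) la.

Lemma strip_partition s : is_partition s -> is_partition (strip s).
Proof. by apply: sorted_filter => x y z /= xy yz; apply: leq_trans yz xy. Qed.

Lemma sumn_strip s : sumn (strip s) = sumn s.
Proof. by elim: s => //= -[|x] s IHs //=; rewrite IHs. Qed.

Lemma strip_pad s : is_partition s -> s = strip s ++ nseq (size s - size (strip s)) 0%N.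
Proof.
elim: s => //= x s IHs ps.
have ps' : is_partition s by apply: path_sorted ps.
case: x ps => [|x] ps /=; last by rewrite subSS -IHs.
have s0 : s = nseq (size s) 0%N.
  apply/all_pred1P/allP => y ys.
  have tr : transitive geq by move=> ? ? ? /= h1 h2; apply: leq_trans h2 h1.
  have := allP (order_path_min tr ps) y ys.
  by rewrite /= leqn0.
have -> : strip s = [::] by rewrite s0; elim: (size s).
by rewrite /= -s0.
Qed.

Lemma size_le_sumn s : 0%N \notin s -> (size s <= sumn s)%N.
Proof.
elim: s => //= x s IHs; rewrite inE negb_or => /andP[x0 /IHs h].
by rewrite -add1n leq_add // lt0n eq_sym.
Qed.

Lemma mem_le_sumn s x : x \in s -> (x <= sumn s)%N.
Proof.
elim: s => //= y s IHs; rewrite inE => /predU1P[->|/IHs h].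
  exact: leq_addr.
exact: leq_trans h (leq_addl _ _).
Qed.

Lemma mem_partitions d s :
  (s \in partitions d) = [&& is_partition s, 0%N \notin s & sumn s == d].
Proof.
apply/mapP/and3P.
  case=> t; rewrite mem_filter => /andP[/andP[pt st] _] ->; split.
  - exact: strip_partition.
  - by rewrite /strip mem_filter.
  - by rewrite sumn_strip.
case=> ps s0 /eqP sd.
have szs : (size s <= d)%N by rewrite -sd size_le_sumn.
pose u := s ++ nseq (d - size s) 0%N.
have szu : size u == d by rewrite size_cat size_nseq subnKC.
pose t := map_tuple (@inord d) (Tuple szu).
have ut : map val t = u.
  rewrite /= -map_comp map_id_in // => x xu /=; rewrite inordK // ltnS.
  move: xu; rewrite mem_cat => /orP[/mem_le_sumn|]; first by rewrite sd.
  by rewrite mem_nseq => /andP[_ /eqP->].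
have sumu : sumn u = d by rewrite sumn_cat sumn_nseq mul0n addn0.
have stripu : strip u = s.
  rewrite /strip filter_cat (all_filterP _); last first.
    by apply/allP => x xs; rewrite lt0n; apply: contraNneq s0 => <-.
  have -> : [seq i <- nseq (d - size s) 0 | 0 < i]%N = [::] by elim: (d - _)%N.
  by rewrite cats0.
exists t; last by rewrite ut.
rewrite mem_filter ut sumu eqxx mem_enum andbT andbT /u /is_partition.
have trg : transitive geq by move=> ? ? ? /= h1 h2; apply: leq_trans h2 h1.
rewrite sorted_pairwise // pairwise_cat -!sorted_pairwise //.
apply/and3P; split => //; first by apply/allrelP => x y _; rewrite mem_nseq => /andP[_ /eqP->].
by elim: (d - _)%N => // -[|k].
Qed.

Lemma partitions_uniq d : uniq (partitions d).
Proof.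
rewrite map_inj_in_uniq => [|t u]; first exact/filter_uniq/enum_uniq.
rewrite !mem_filter => /andP[/andP[pt _] _] /andP[/andP[pu _] _] tu.
apply/val_inj/(inj_map val_inj) => /=.
by rewrite (strip_pad pt) (strip_pad pu) tu !size_map !size_tuple.
Qed.

Lemma mem_MPstar b r g e :
  ((g, e) \in MPstar b r) =
  [&& is_partition g, 0%N \notin g, is_partition e, 0%N \notin e,
      (sumn g + sumn e == r)%N, size g == b, uniq g & all (leq 2) e].
Proof.
rewrite mem_filter andbC [(g, e).1]/fst [(g, e).2]/snd.
case: [&& size g == b, _ & _]; last by rewrite !andbF.
rewrite !andbT; apply/flatten_mapP/and5P.
  case=> k; rewrite mem_iota add0n ltnS => /= kr /allpairsP[[g' e'] /= []].
  rewrite !mem_partitions => /and3P[? ? /eqP gk] /and3P[? ? /eqP ek] [-> ->].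
  by split=> //; rewrite gk ek subnKC.
case=> pg g0 pe e0 /eqP ge; exists (sumn g).
  by rewrite mem_iota add0n ltnS -ge leq_addr.
apply/allpairsP; exists (g, e); rewrite /= !mem_partitions pg g0 pe e0 eqxx.
by rewrite -ge addKn eqxx.
Qed.

Lemma MPstar_uniq b r : uniq (MPstar b r).
Proof.
apply: filter_uniq.
pose f k := [seq (g, e) | g <- partitions k, e <- partitions (r - k)].
rewrite -/(uniq (flatten (map f (iota 0 r.+1)))).
elim: (iota _ _) (iota_uniq 0 r.+1) => //= k ks IHks /andP[kks /IHks uks].
rewrite cat_uniq uks andbT; apply/andP; split.
  by apply: allpairs_uniq; rewrite ?partitions_uniq // => -[? ?] [? ?].
apply/hasPn => -[g e] /flatten_mapP[l lks /allpairsP[[g' e'] /= [gl _ [-> _]]]].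
apply/negP => /allpairsP[[g'' e''] /= [gk _ [gg _]]].
move: gl gk; rewrite -gg !mem_partitions.
case/and3P=> _ _ /eqP gl /and3P[_ _ /eqP gk].
by move: kks; rewrite -gk gl lks.
Qed.

(* Main.v *)
(* Removing the letters one at a time, each along a horizontal strip, computes *)
(* s_la at a finite alphabet in any commutative ring.  The two removal         *)
(* operators for letters x and y commute (the Bender-Knuth involution on       *)
(* interlacing sequences), so s_la is symmetric, zero letters do not count,    *)
(* and s_nu o h_m is s_nu evaluated at the list of monomials of degree m.  Its *)
(* Schur expansion exists because the Kostka numbers are unitriangular, and    *)
(* the coefficients are read off by evaluating the expansion twice.            *)
(*   At the alphabet {1, X}, the coefficient of X^r in (1 - X) s_la(1, X) is   *)
(* 1 for la = (d - r, r) and 0 for the other partitions la of d, if 2 r <= d.  *)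
(* On the other side, with a = n - b - 1,                                      *)
(*   (1 - X) s_(a+1, 1^b)(1, X, .., X^m)                                       *)
(*     = h_a(1, X^2, .., X^m) e_b(X, .., X^m)   mod X^n,                       *)
(* where the right-hand side counts the pairs (gamma, epsilon).                *)
(*   At one even letter 1 and one odd letter t, s_la vanishes unless la is a   *)
(* hook (a, 1^k), whose value is t^k (1 + t); and h_m takes the value 1 + t    *)
(* for all m, so the hook s_nu o h_m takes the same value as s_nu.  The odd    *)
(* letter is realised by the letters - t z^i, 0 < i < N, for z a primitive     *)
(* N-th root of unity with N large: together with - t itself they form an      *)
(* alphabet at which symmetric functions of positive degree less than N        *)
(* vanish.                                                                     *)

From Stdlib Require Import ClassicalEpsilon.
Require Import Defs.
From mathcomp Require Import all_boot all_order all_algebra all_field.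
From mathcomp Require Import mpoly ring zify.

Set Implicit Arguments.
Unset Strict Implicit.
Unset Printing Implicit Defensive.

Import Order.TTheory GRing.Theory Num.Theory.
Local Open Scope ring_scope.

(** * Horizontal strips *)

(** Expand s_nu o h_m in Schur functions with coefficients c ([schur_expansion_exists]). Each
    alphabet gives a linear equation for c ([schur_expansion_eval]), and for each of the two
    families of shapes there is an alphabet at which one coefficient can be isolated.

    For two rows the alphabet is {1, X}: multiplying by 1 - X turns s_(a,b) into X^b - X^(a+1), so
    degree r isolates (d - r, r) ([two_row_coef]). The monomials of degree m are 1, X, .., X^m.
    Reading 1 as the smallest letter splits a hook into corner, arm and leg ([schur_eval_hook]), and
    up to degree r this leaves a product h_a e_b with a = n - b - 1 ([coef_hook]). Here e_b selects
    the b distinct parts of gamma and h_a the parts of epsilon; the bounds on n and m make the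
    limits on the number and size of the parts vacuous ([size_hook_pairs]).

    For hooks the alphabet is (1 | t), with one even and one odd letter. Only hooks survive there,
    and each h_m with m > 0 sends the alphabet to itself, so s_nu o h_m and s_nu agree on it;
    dividing by 1 + t and comparing powers of t gives [r = b] ([plethysm_hook_coef]). Roots of unity
    realise the odd letter ([peel_hlist_roots]), and cancelling the letter - t identifies the values
    ([peel_inj]). *)

Lemma geq_transitive : transitive geq.
Proof. by move=> ? ? ? /= h1 h2; apply: leq_trans h2 h1. Qed.

Lemma gtn_transitive : transitive gtn.
Proof. by move=> ? ? ? /= h1 h2; apply: ltn_trans h2 h1. Qed.

(* The partitions mu, padded with zeros to the length of la, such that la / mu *)
(* is a horizontal strip: la_0 >= mu_0 >= la_1 >= mu_1 >= ...                  *)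
Fixpoint hstrips (la : seq nat) : seq (seq nat) :=
  if la is a :: t
  then [seq j :: u | j <- [seq j <- index_iota 0 a.+1 | head 0 t <= j]%N,
                     u <- hstrips t]
  else [:: [::]].
Arguments hstrips : simpl never.

Lemma hstrips_cons a t j u :
  (j :: u \in hstrips (a :: t)) = (head 0%N t <= j <= a)%N && (u \in hstrips t).
Proof.
apply/allpairsP/andP => [[[j' u'] [hj hu [-> ->]]]|[hj hu]].
  by split=> //; move: hj; rewrite mem_filter mem_index_iota ltnS.
by exists (j, u); split=> //; rewrite mem_filter mem_index_iota ltnS.
Qed.

Lemma nil_hstrips a t : ([::] \in hstrips (a :: t)) = false.
Proof. by apply/allpairsP => -[[j u] /= [_ _]]. Qed.

Lemma hstripsP la mu : reflect
  (size mu = size la /\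
   forall i, (nth 0%N la i.+1 <= nth 0%N mu i <= nth 0%N la i)%N)
  (mu \in hstrips la).
Proof.
elim: la mu => [|a t IHt] [|j u] /=.
- by left; split=> // i; rewrite !nth_nil.
- by right=> -[].
- by rewrite nil_hstrips; right=> -[].
rewrite hstrips_cons; apply: (iffP andP) => [[hj /IHt [su hu]]|[[su] hu]].
  by split=> [|[|i]] //=; rewrite ?su // nth0.
split; first by have := hu 0%N; rewrite /= nth0.
by apply/IHt; split=> // i; apply: (hu i.+1).
Qed.

Lemma hstrips_uniq la : uniq (hstrips la).
Proof.
elim: la => // a t IHt.
by apply: allpairs_uniq; rewrite // ?filter_uniq ?iota_uniq // => -[? ?] [? ?] _ _ [-> ->].
Qed.

Lemma hstrips_sumn la mu : mu \in hstrips la -> (sumn mu <= sumn la)%N.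
Proof.
elim: la mu => [|a t IHt] [|j u] //=.
by rewrite hstrips_cons => /andP[/andP[_ ja] /IHt]; lia.
Qed.

Lemma hstrips_partition la mu : mu \in hstrips la -> is_partition mu.
Proof.
elim: la mu => [|a t IHt] [|j u] //.
rewrite hstrips_cons => /andP[/andP[tj _] uh]; have /= := IHt _ uh.
case: t u tj uh {IHt} => [|a' t] [|j' u] //= tj.
by rewrite hstrips_cons => /andP[/andP[_ ja] _] ->; rewrite andbT /=; lia.
Qed.

Lemma hstrips_refl la : is_partition la -> la \in hstrips la.
Proof.
move=> pla; apply/hstripsP; split=> // i; rewrite leqnn andbT.
have [il|il] := ltnP i.+1 (size la); last by rewrite nth_default.
by have /(sortedP 0%N)/(_ i il) := pla.
Qed.

Lemma hstrips_full la mu :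
  mu \in hstrips la -> sumn mu = sumn la -> mu = la.
Proof.
elim: la mu => [|a t IHt] [|j u] //=; rewrite ?nil_hstrips //.
rewrite hstrips_cons => /andP[/andP[_ ja] uh] e.
have h := hstrips_sumn uh.
by have -> : j = a by [lia]; rewrite (IHt u uh) //; lia.
Qed.

Section Peel.

Variable R : comNzRingType.
Implicit Types (x y : R) (phi psi : seq nat -> R) (L : seq R).

Definition peel x phi la : R :=
  \sum_(mu <- hstrips la) x ^+ (sumn la - sumn mu) * phi mu.

Lemma eq_in_peel x phi psi la :
  {in hstrips la, phi =1 psi} -> peel x phi la = peel x psi la.
Proof. by move=> e; apply: eq_big_seq => mu /e ->. Qed.

Lemma eq_peel x phi psi : phi =1 psi -> peel x phi =1 peel x psi.
Proof. by move=> e la; apply: eq_in_peel => mu _. Qed.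

Lemma peel_nil x phi : peel x phi [::] = phi [::].
Proof. by rewrite /peel big_seq1 subnn mul1r. Qed.

Lemma peel_cons x phi a t :
  peel x phi (a :: t) =
  \sum_(0 <= j < a.+1 | (head 0 t <= j)%N)
     x ^+ (a - j) * peel x (fun u => phi (j :: u)) t.
Proof.
rewrite /peel big_allpairs_dep big_filter.
rewrite big_nat_cond [RHS]big_nat_cond; apply: eq_bigr => j hj.
rewrite big_distrr /= big_seq [RHS]big_seq; apply: eq_bigr => u /hstrips_sumn hu.
by rewrite mulrA -exprD; congr (_ ^+ _ * _); lia.
Qed.

Lemma peelZ x c phi la : peel x (fun mu => c * phi mu) la = c * peel x phi la.
Proof. by rewrite big_distrr; apply: eq_bigr => mu _ /=; rewrite mulrCA. Qed.

Lemma peel0 phi la : is_partition la -> peel 0 phi la = phi la.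
Proof.
move=> pla; rewrite /peel (bigD1_seq la) ?hstrips_refl ?hstrips_uniq //=.
rewrite subnn mul1r big_seq_cond big1 ?addr0 // => mu /andP[hmu ne].
rewrite expr0n subn_eq0 leqNgt.
have : (sumn mu < sumn la)%N.
  rewrite ltn_neqAle hstrips_sumn // andbT.
  by apply: contraNneq ne => /hstrips_full ->.
by move=> ->; rewrite mul0r.
Qed.

(* The first row of the intermediate partition is at most u; the commutation   *)
(* of [peel x] and [peel y] is the case of a large u.                          *)
Definition peel2 u x y phi la : R :=
  peel x (fun mu => (head 0%N mu <= u)%N%:R * peel y phi mu) la.

(** Once the first row i of the innermost partition is fixed, the later rows see the first row j of
    the middle one only through the bounds on j, so the sum over j splits off; i becomes the bound
    for the rows below. *)
Lemma peel2_cons u x y phi a t :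
  peel2 u x y phi (a :: t) =
  \sum_(0 <= i < a.+1) peel2 i x y (fun nu => phi (i :: nu)) t *
    \sum_(0 <= j < a.+1 | [&& head 0 t <= j, i <= j & j <= u]%N)
       x ^+ (a - j) * y ^+ (j - i).
Proof.
have term j mu : (j <= a)%N ->
    (j <= u)%N%:R * peel y phi (j :: mu) =
    \sum_(0 <= i < a.+1) ((i <= j) && (j <= u))%N%:R * (y ^+ (j - i) *
      ((head 0 mu <= i)%N%:R * peel y (fun nu => phi (i :: nu)) mu)).
  move=> ja; rewrite peel_cons [RHS](@big_cat_nat _ _ _ j.+1) //=.
  rewrite [X in _ + X]big_nat [X in _ + X]big1 ?addr0; last first.
    by move=> i /andP[ij _]; rewrite leqNgt ij mul0r.
  rewrite [X in _ * X]big_mkcond big_distrr /=; apply: eq_big_nat => i /andP[_].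
  rewrite ltnS => ->; case: (j <= u)%N; rewrite ?mul0r // !mul1r.
  by case: (head 0 mu <= i)%N; rewrite ?mul1r ?mul0r ?mulr0.
rewrite /peel2 peel_cons big_nat_cond.
under eq_bigr => j /andP[/andP[_ ja] _].
  under eq_peel => mu do rewrite /= (term j mu ja).
  rewrite /peel; under eq_bigr => mu _ do rewrite big_distrr /=.
  rewrite exchange_big /= big_distrr /=.
  over.
rewrite -big_nat_cond exchange_big /=; apply: eq_bigr => i _.
rewrite big_distrr /= big_mkcond [RHS]big_mkcond; apply: eq_bigr => j _.
case: leqP => //= tj; case: ifP => // _; last first.
  by rewrite big1 ?mulr0 // => mu _; rewrite mul0r mulr0.
rewrite /peel mulrCA; congr (_ * _); rewrite mulrC big_distrr /=.
by apply: eq_bigr => mu _; rewrite mul1r mulrCA.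
Qed.

(** The middle row j runs over the interval from max(h, i) to min(a, u). Reversing this interval,
    which is the Bender-Knuth involution on one row, exchanges x and y in the common factor Z; the
    outer powers measure how far a exceeds u and h exceeds i. *)
Lemma row_sum_sym a h i u x y :
  exists Z,
    \sum_(0 <= j < a.+1 | [&& h <= j, i <= j & j <= u]%N)
       x ^+ (a - j) * y ^+ (j - i) = x ^+ (a - u) * (y ^+ (h - i) * Z) /\
    \sum_(0 <= j < a.+1 | [&& h <= j, i <= j & j <= u]%N)
       y ^+ (a - j) * x ^+ (j - i) = y ^+ (a - u) * (x ^+ (h - i) * Z).
Proof.
pose Z x' y' : R := \sum_(maxn h i <= j < (minn a u).+1)
  x' ^+ (minn a u - j) * y' ^+ (j - maxn h i).
have Zsym x' y' : Z x' y' = Z y' x'.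
  rewrite /Z big_nat_rev big_nat [RHS]big_nat; apply: eq_bigr => j hj.
  by rewrite mulrC; congr (_ ^+ _ * _ ^+ _); lia.
have E x' y' : \sum_(0 <= j < a.+1 | [&& h <= j, i <= j & j <= u]%N)
    x' ^+ (a - j) * y' ^+ (j - i) = x' ^+ (a - u) * (y' ^+ (h - i) * Z x' y').
  rewrite /Z !big_distrr /= [RHS](@big_nat_widen _ _ _ _ _ a.+1); last by lia.
  rewrite [RHS](@big_nat_widenl _ _ _ _ 0%N) //=.
  rewrite big_nat_cond [RHS]big_nat_cond; apply: eq_big => j; first by lia.
  move=> hj; have -> : (a - j = (a - u) + (minn a u - j))%N by lia.
  have -> : (j - i = (h - i) + (j - maxn h i))%N by lia.
  by rewrite !exprD; ring.
by exists (Z x y); rewrite {2}Zsym !E.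
Qed.

(** The power of y or x left over by one row in [row_sum_sym] is exactly the factor required by the
    induction hypothesis for the next row. *)
Lemma peel2_swap u x y phi la :
  y ^+ (head 0%N la - u) * peel2 u x y phi la =
  x ^+ (head 0%N la - u) * peel2 u y x phi la.
Proof.
elim: la u phi => [|a t IHt] u phi.
  by rewrite /peel2 !peel_nil !mul1r.
rewrite !peel2_cons !big_distrr; apply: eq_bigr => i _ /=.
have [Z [-> ->]] := row_sum_sym a (head 0%N t) i u x y.
by ring: (IHt i (fun nu => phi (i :: nu))).
Qed.

Lemma peelC x y phi la : peel x (peel y phi) la = peel y (peel x phi) la.
Proof.
have E x' y' : peel2 (head 0%N la) x' y' phi la = peel x' (peel y' phi) la.
  apply: eq_in_peel => mu /hstripsP[_ /(_ 0%N)]; rewrite !nth0 => /andP[_ ->].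
  by rewrite mul1r.
by have := peel2_swap (head 0%N la) x y phi la; rewrite subnn !mul1r !E.
Qed.

Lemma peel_rcons0 x phi la :
  peel x phi (rcons la 0%N) = peel x (fun mu => phi (rcons mu 0%N)) la.
Proof.
elim: la phi => [|a t IHt] phi.
  by rewrite /= peel_cons peel_nil big_mkcond big_nat1 peel_nil mul1r.
rewrite /= !peel_cons.
have -> : head 0%N (rcons t 0%N) = head 0%N t by case: (t).
by apply: eq_bigr => j _; rewrite IHt.
Qed.

Definition peels phi L : seq nat -> R := foldr peel phi L.

Lemma eq_peels phi psi L : phi =1 psi -> peels phi L =1 peels psi L.
Proof. by move=> e; elim: L => //= x L IHL la; apply: eq_peel. Qed.

Lemma peels_cat phi L1 L2 la :
  peels phi (L1 ++ L2) la = peels (peels phi L2) L1 la.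
Proof. by rewrite /peels foldr_cat. Qed.

Lemma peels_rot1 phi L1 x L2 :
  peels phi (L1 ++ x :: L2) =1 peels phi (x :: L1 ++ L2).
Proof.
elim: L1 => //= y L1 IHL la; rewrite [RHS]peelC; apply: eq_peel => mu.
exact: IHL.
Qed.

Lemma perm_peels phi L1 L2 : perm_eq L1 L2 -> peels phi L1 =1 peels phi L2.
Proof.
elim: L1 L2 => [|x L1 IHL] L2.
  by rewrite perm_sym => /perm_nilP ->.
move=> e; have xL : x \in L2 by rewrite -(perm_mem e) mem_head.
case/splitPr: xL e => L3 L4.
rewrite perm_sym perm_catC /= perm_cons perm_catC perm_sym => /IHL e la.
by rewrite peels_rot1; apply: eq_peel.
Qed.

Lemma peels_zeros phi k L la :
  is_partition la -> peels phi (nseq k 0 ++ L) la = peels phi L la.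
Proof. by move=> pla; elim: k => //= k IHk; rewrite peel0. Qed.

Definition delta_empty (la : seq nat) : R := (sumn la == 0%N)%:R.

(** The branching rule taken as a definition of s_la at the alphabet L. It accepts letters of any
    commutative ring, so monomials, powers of X and multiples of roots of unity are all treated
    alike. *)
Definition schur_eval la L : R := peels delta_empty L la.

Lemma schur_eval_cons la x L :
  schur_eval la (x :: L) = peel x (schur_eval^~ L) la.
Proof. by []. Qed.

Lemma schur_eval_rcons0 la L : schur_eval (rcons la 0%N) L = schur_eval la L.
Proof.
rewrite /schur_eval; elim: L la => [|x L IHL] la /=.
  by rewrite /delta_empty sumn_rcons addn0.
by rewrite peel_rcons0; apply: eq_peel.
Qed.

Lemma perm_schur_eval la L1 L2 :
  perm_eq L1 L2 -> schur_eval la L1 = schur_eval la L2.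
Proof. by move/perm_peels; apply. Qed.

End Peel.

Arguments delta_empty {R}.

Lemma rmorph_peel (R S : comNzRingType) (f : {rmorphism R -> S}) x phi la :
  f (peel x phi la) = peel (f x) (f \o phi) la.
Proof.
rewrite rmorph_sum; apply: eq_bigr => mu _.
by rewrite rmorphM rmorphXn.
Qed.

Lemma rmorph_peels (R S : comNzRingType) (f : {rmorphism R -> S}) phi L la :
  f (peels phi L la) = peels (f \o phi) (map f L) la.
Proof.
elim: L la => //= x L IHL la; rewrite rmorph_peel; exact: eq_peel.
Qed.

Lemma rmorph_schur_eval (R S : comNzRingType) (f : {rmorphism R -> S}) la L :
  f (schur_eval la L) = schur_eval la (map f L).
Proof.
rewrite /schur_eval rmorph_peels; apply: eq_peels => mu /=.
exact: rmorph_nat.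
Qed.

(** * Semistandard tableaux *)

Section Tableaux.

Variables (R : comNzRingType) (la : seq nat) (N : nat) (d : 'I_N) (w : 'I_N -> R).
Implicit Types (mu nu : seq nat) (c : cell la) (T : {ffun cell la -> 'I_N}).

Definition row c : nat := tag c.
Definition col c : nat := tagged c.
Definition in_shape mu c := (col c < nth 0 mu (row c))%N.

Lemma cell_at i j : (j < nth 0 la i)%N ->
  exists c, row c = i /\ col c = j.
Proof.
move=> ji; have il : (i < size la)%N.
  by rewrite ltnNge; apply/negP => ?; rewrite nth_default in ji.
by exists (Tagged (fun i : 'I_(size la) => 'I_(nth 0%N la i))
                  (Ordinal (ji : (j < nth 0 la (Ordinal il))%N))).
Qed.

Lemma cell_inj c c' : row c = row c' -> col c = col c' -> c = c'.
Proof.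
case: c c' => i j [i' j']; rewrite /row /col /= => /val_inj ei.
by case: i' / ei j' => j' /val_inj ->.
Qed.

Lemma card_in_shape mu : size mu = size la ->
  (forall i, (nth 0 mu i <= nth 0 la i)%N) -> #|[pred c | in_shape mu c]| = sumn mu.
Proof.
move=> sz sub; rewrite -sum1_card.
transitivity (\sum_(i < size la) \sum_(j < nth 0%N la i | (j < nth 0 mu i)%N) 1)%N.
  by rewrite sig_big_dep.
rewrite -[mu in RHS](mkseq_nth 0%N) sz sumnE big_map.
rewrite -[size la in RHS]subn0 big_mkord.
apply: eq_bigr => i _; transitivity (\sum_(0 <= j < nth 0 mu i) 1)%N.
  by rewrite (@big_nat_widen _ _ _ _ _ (nth 0%N la i)) // big_mkord.
by rewrite sum_nat_const_nat muln1 subn0.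
Qed.

(* The fillings of the shapes mu inside la all live on the cells of la, with   *)
(* the default letter d outside mu.                                            *)
Definition filling k mu T :=
  [forall c, if in_shape mu c then (T c < k)%N else T c == d] &&
  [forall c, forall c', in_shape mu c && in_shape mu c' ==>
     (((tag c == tag c') && (tagged c <= tagged c')%N ==> (T c <= T c')%N)
     && ((tagged c == tagged c' :> nat) && (tag c < tag c')%N
         ==> (T c < T c')%N))].

Lemma fillingP k mu T : reflect
  [/\ forall c, in_shape mu c -> (T c < k)%N,
      forall c, ~~ in_shape mu c -> T c = d,
      forall c c', in_shape mu c -> in_shape mu c' ->
        row c = row c' -> (col c <= col c')%N -> (T c <= T c')%N
    & forall c c', in_shape mu c -> in_shape mu c' ->
        col c = col c' -> (row c < row c')%N -> (T c < T c')%N]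
  (filling k mu T).
Proof.
apply: (iffP andP) => [[/forallP h1 /forallP h2]|[h1 h2 h3 h4]].
  split.
  - by move=> c hc; have := h1 c; rewrite hc.
  - by move=> c hc; have := h1 c; rewrite (negPf hc) => /eqP.
  - move=> c c' hc hc' e l; have /forallP/(_ c')/implyP := h2 c.
    rewrite hc hc' => /(_ isT)/andP[/implyP h _]; apply: h.
    by rewrite l andbT; apply/eqP/val_inj.
  - move=> c c' hc hc' e l; have /forallP/(_ c')/implyP := h2 c.
    rewrite hc hc' => /(_ isT)/andP[_ /implyP h]; apply: h.
    by rewrite l andbT; apply/eqP.
split; apply/forallP => c.
  by case: ifPn => [/h1|/h2/eqP].
apply/forallP => c'; apply/implyP => /andP[hc hc']; apply/andP; split.
  by apply/implyP => /andP[/eqP e l]; apply: h3 => //; apply: congr1 e.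
by apply/implyP => /andP[/eqP e l]; apply: h4.
Qed.

Definition agrees k mu T nu :=
  [forall c, in_shape mu c ==> ((T c < k)%N == in_shape nu c)].

Lemma agrees_unique k mu T nu nu' :
  (forall i, (nth 0 mu i <= nth 0 la i)%N) ->
  nu \in hstrips mu -> nu' \in hstrips mu -> agrees k mu T nu ->
  agrees k mu T nu' -> nu = nu'.
Proof.
move=> sub /hstripsP[s1 h1] /hstripsP[s2 h2] /forallP a1 /forallP a2.
apply: (@eq_from_nth _ 0%N) => [|i _]; first by rewrite s1 s2.
have key j : (j < nth 0 mu i)%N -> (j < nth 0 nu i)%N = (j < nth 0 nu' i)%N.
  move=> ji; have [c [ei ej]] := cell_at (leq_trans ji (sub i)).
  have := a1 c; have := a2 c; rewrite /in_shape ei ej ji /=.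
  by move=> /eqP <- /eqP <-.
have [l1 l2] : (nth 0 nu i <= nth 0 mu i)%N /\ (nth 0 nu' i <= nth 0 mu i)%N.
  by split; [case/andP: (h1 i) | case/andP: (h2 i)].
apply/eqP; rewrite eqn_leq; apply/andP; split; rewrite leqNgt; apply/negP => lt.
  by have := key _ (leq_trans lt l1); rewrite lt ltnn.
by have := key _ (leq_trans lt l2); rewrite lt ltnn.
Qed.

(** Rows increase weakly, so the letters below k form an initial segment of each row; columns
    increase strictly, so the remaining letters, all equal to k, form a horizontal strip. *)
Lemma agrees_exists k mu T : size mu = size la -> is_partition mu ->
  (forall i, (nth 0 mu i <= nth 0 la i)%N) -> filling k.+1 mu T ->
  exists2 nu, nu \in hstrips mu & agrees k mu T nu.
Proof.
move=> sz pmu sub /fillingP[f1 f2 f3 f4].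
have mono i : (nth 0 mu i.+1 <= nth 0 mu i)%N.
  by case/hstripsP: (hstrips_refl pmu) => _ /(_ i) /andP[].
pose small i j := [exists c, [&& row c == i, col c == j & (T c < k)%N]].
(* [g i] is the length of the initial segment of row i with entries below k. *)
pose g i := find (predC (small i)) (iota 0 (nth 0%N mu i)).
have g_le i : (g i <= nth 0 mu i)%N by rewrite -[leqRHS](size_iota 0) find_size.
have g_small i j : (j < g i)%N -> small i j.
  move=> ji; have := before_find 0%N ji; rewrite nth_iota ?(leq_trans ji) //=.
  by move/negbFE.
have g_big i : (g i < nth 0 mu i)%N -> ~~ small i (g i).
  move=> gi; have : has (predC (small i)) (iota 0 (nth 0%N mu i)).
    by rewrite has_find size_iota.
  by move/(nth_find 0%N); rewrite nth_iota.
have gP c : in_shape mu c -> (T c < k)%N = (col c < g (row c))%N.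
  move=> hc; apply/idP/idP => [Tk|]; last first.
    case/g_small/existsP => c' /and3P[/eqP e1 /eqP e2 Tc'].
    by rewrite (cell_inj (esym e1) (esym e2)).
  rewrite ltnNge; apply/negP => le.
  have gi : (g (row c) < nth 0 mu (row c))%N by apply: leq_ltn_trans le hc.
  have [c' [e1 e2]] := cell_at (leq_trans gi (sub _)).
  have hc' : in_shape mu c' by rewrite /in_shape e1 e2.
  have := g_big _ gi; apply/negP/negPn/existsP; exists c'.
  by rewrite e1 e2 !eqxx /=; apply: leq_ltn_trans Tk; apply: f3; rewrite ?e2.
exists (mkseq g (size mu)).
  apply/hstripsP; split=> [|i]; first by rewrite size_mkseq.
  have [il|il] := ltnP i (size mu); last first.
    by rewrite [nth _ mu _]nth_default ?(leq_trans il) // nth_default ?size_mkseq.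
  (* If row i + 1 of mu were longer than [g i], the cells of column [g i] in rows i and i + 1 would
     both lie in mu; the upper entry is at least k, so the lower one would exceed k. *)
  rewrite nth_mkseq // g_le andbT leqNgt; apply/negP => lt.
  have gi : (g i < nth 0 mu i)%N by apply: leq_trans lt (mono i).
  have [c [e1 e2]] := cell_at (leq_trans gi (sub _)).
  have [c' [e1' e2']] := cell_at (leq_trans lt (sub _)).
  have hc : in_shape mu c by rewrite /in_shape e1 e2.
  have hc' : in_shape mu c' by rewrite /in_shape e1' e2'.
  have := gP c hc; rewrite e1 e2 ltnn => /negbT; rewrite -leqNgt => kT.
  have := f4 c c' hc hc'; rewrite e1 e1' e2 e2' => /(_ erefl (ltnSn i)) lt'.
  by move/(leq_ltn_trans kT): lt'; rewrite ltnNge -ltnS f1.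
apply/forallP => c; apply/implyP => hc; rewrite /in_shape nth_mkseq ?gP //.
by rewrite sz ltn_ord.
Qed.

Definition extend k mu nu T : {ffun cell la -> 'I_N} :=
  [ffun c => if in_shape mu c && ~~ in_shape nu c then k else T c].

Definition restrict nu T : {ffun cell la -> 'I_N} :=
  [ffun c => if in_shape nu c then T c else d].

Lemma sub_in_shape mu nu c : nu \in hstrips mu -> in_shape nu c -> in_shape mu c.
Proof.
case/hstripsP=> _ /(_ (row c))/andP[_ h] l; exact: leq_trans l h.
Qed.

Lemma restrictK (k : 'I_N) mu nu T : nu \in hstrips mu ->
  filling k.+1 mu T && agrees k mu T nu -> extend k mu nu (restrict nu T) = T.
Proof.
move=> hnu /andP[/fillingP[f1 f2 _ _] /forallP a]; apply/ffunP => c; rewrite !ffunE.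
have := a c; have := @sub_in_shape mu nu c hnu.
case hm: (in_shape mu c); case hn: (in_shape nu c) => //= h.
- move/eqP => Tk; apply/val_inj/eqP; rewrite /= eqn_leq.
  by have := f1 c hm; rewrite ltnS => ->; rewrite leqNgt Tk.
- by rewrite f2 ?hm.
Qed.

(** Together with [restrictK] this is the bijection between fillings of mu whose letters below k
    have shape nu and fillings of nu, in the form that [reindex_onto] asks for. *)
Lemma extend_filling (k : 'I_N) mu nu T : nu \in hstrips mu -> is_partition mu ->
  (filling k.+1 mu (extend k mu nu T) && agrees k mu (extend k mu nu T) nu) &&
     (restrict nu (extend k mu nu T) == T) = filling k nu T.
Proof.
move=> hnu pmu; have hsub c : in_shape nu c -> in_shape mu c by apply: sub_in_shape.
have Ein c : in_shape nu c -> extend k mu nu T c = T c.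
  by move=> hc; rewrite ffunE hc andbF.
have Eout c : in_shape mu c -> ~~ in_shape nu c -> extend k mu nu T c = k.
  by move=> hc hn; rewrite ffunE hc hn.
apply/idP/idP.
  case/andP=> /andP[/fillingP[f1 f2 f3 f4] /forallP a] /eqP/ffunP r.
  have out c : ~~ in_shape nu c -> T c = d.
    by move=> hc; rewrite -r ffunE (negPf hc).
  apply/fillingP; split=> //.
  - move=> c hc; have := a c; by rewrite Ein ?hc ?hsub //= => /eqP ->.
  - by move=> c c' hc hc' e l; have := f3 c c'; rewrite !Ein // !hsub //; apply.
  - by move=> c c' hc hc' e l; have := f4 c c'; rewrite !Ein // !hsub //; apply.
case/fillingP=> f1 f2 f3 f4; apply/andP; split; last first.
  apply/eqP/ffunP => c; rewrite !ffunE; case: ifPn => hc; last by rewrite f2.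
  by rewrite hc andbF.
apply/andP; split; last first.
  apply/forallP => c; apply/implyP => hc; apply/eqP.
  case hn: (in_shape nu c); first by rewrite Ein // f1.
  by rewrite Eout ?hn // ltnn.
apply/fillingP; split.
- move=> c hc; case hn: (in_shape nu c); last by rewrite Eout ?hn.
  by rewrite Ein // ltnS ltnW // f1.
- by move=> c hc; rewrite ffunE (negPf hc) f2 //; apply: contraNN hc; apply: hsub.
- move=> c c' hc hc' e l; case hn: (in_shape nu c'); last first.
    rewrite (Eout c') ?hn //; case hn': (in_shape nu c); last by rewrite Eout ?hn'.
    by rewrite Ein // ltnW // f1.
  have hn' : in_shape nu c.
    by rewrite /in_shape e; apply: leq_ltn_trans l _.
  by rewrite !Ein //; apply: f3.
- move=> c c' hc hc' e l.
  (* The cell c lies above a cell of mu in its column, and a horizontal strip leaves such a cell in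
     nu. *)
  have hn : in_shape nu c.
    have/hstripsP[_ h] := hnu; rewrite /in_shape e.
    apply: leq_trans hc' _; apply: (@leq_trans (nth 0%N mu (row c).+1)).
      2: by case/andP: (h (row c)).
    have [il|il] := ltnP (row c') (size mu); last by rewrite nth_default.
    apply: (sorted_leq_nth _ _ 0%N pmu) => //; rewrite ?inE.
    - exact: geq_transitive.
    - exact: leqnn.
    - exact: leq_ltn_trans l il.
  rewrite (Ein c) //; case hn': (in_shape nu c'); last by rewrite Eout ?hn' ?f1.
  by rewrite Ein //; apply: f4.
Qed.

(** Induction on the number of letters: fillings are grouped by the shape nu of their letters below
    the largest one, which fills mu / nu. The list is reversed because the largest letter is peeled
    first. *)
Lemma sum_filling mu k : (k <= N)%N -> size mu = size la -> is_partition mu ->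
  (forall i, (nth 0 mu i <= nth 0 la i)%N) ->
  \sum_(T | filling k mu T) \prod_(c | in_shape mu c) w (T c) =
  schur_eval mu (rev [seq w i | i <- take k (enum 'I_N)]).
Proof.
elim: k mu => [|k IHk] mu kN sz pmu sub.
  rewrite take0 /= /delta_empty; case: eqP => [mu0|mu0].
    have out c : in_shape mu c = false.
      have mu0' : mu = nseq (size mu) 0%N.
        apply/all_pred1P/allP => x xmu /=.
        by have := mem_le_sumn xmu; rewrite mu0 leqn0.
      by rewrite /in_shape mu0' nth_nseq if_same.
    rewrite (big_pred1 [ffun=> d]) => [|T].
      by rewrite big_pred0.
    apply/fillingP/eqP => [[_ h _ _]|->].
      by apply/ffunP => c; rewrite ffunE h ?out.
    by split=> [c|c|c c'|c c']; rewrite ?out // ffunE.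
  rewrite big_pred0 // => T; apply/negP => /fillingP[h _ _ _].
  apply: mu0; rewrite -card_in_shape //; apply: eq_card0 => c; rewrite inE.
  by apply/negP => /h.
have [kN'] : exists k' : 'I_N, k' = k :> nat by exists (Ordinal kN).
move=> ek; rewrite -ek in IHk kN *; move: kN' IHk kN {ek} => kk IHk kN {k}.
rewrite (take_nth d) ?size_enum_ord // map_rcons rev_rcons nth_ord_enum schur_eval_cons.
have hsub nu : nu \in hstrips mu ->
    [/\ size nu = size la, is_partition nu & forall i, (nth 0 nu i <= nth 0 la i)%N].
  move=> hnu; split; last first.
  - move=> i; case/hstripsP: hnu => _ /(_ i) /andP[_ l].
    exact: leq_trans l (sub i).
  - exact: hstrips_partition hnu.
  - by case/hstripsP: hnu => ->.
transitivity (\sum_(nu <- hstrips mu)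
    \sum_(T | filling kk.+1 mu T && agrees kk mu T nu)
       \prod_(c | in_shape mu c) w (T c)).
  under [RHS]eq_bigr => nu _ do rewrite big_mkcondr /=.
  rewrite exchange_big /=; apply: eq_bigr => T hT.
  have [nu hnu ag] := agrees_exists sz pmu sub hT.
  rewrite (bigD1_seq nu) ?hstrips_uniq //= ag.
  rewrite [X in _ = _ + X]big_seq_cond [X in _ = _ + X]big1 ?addr0 // => nu'.
  case/andP=> hnu' ne; case: ifP => // ag'.
  by rewrite (agrees_unique sub hnu' hnu ag' ag) eqxx in ne.
apply: eq_big_seq => nu hnu; have [s1 s2 s3] := hsub nu hnu.
rewrite (reindex_onto (extend kk mu nu) (restrict nu)); last first.
  by move=> T; apply: restrictK.
rewrite -IHk ?(ltnW kN) // big_distrr /=.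
apply: eq_big => [T|T hT]; first exact: extend_filling.
rewrite (bigID (in_shape nu)) /= mulrC; congr (_ * _).
  rewrite (eq_bigr (fun=> w kk)) => [|c hc]; last by rewrite ffunE hc.
  rewrite prodr_const; congr (_ ^+ _); rewrite -!card_in_shape //.
  rewrite -(cardID [pred c | in_shape nu c] [pred c | in_shape mu c]).
  rewrite [X in (X + _ - _)%N](_ : _ = #|[pred c | in_shape nu c]|); last first.
    apply: eq_card => c; rewrite !inE andbC; case hc: (in_shape nu c) => //=.
    exact: sub_in_shape hc.
  by rewrite addKn; apply: eq_card => c; rewrite !inE andbC.
apply: eq_big => c; first by case hc: (in_shape nu c); rewrite ?andbF // (sub_in_shape hnu).
by case/andP=> _ hc; rewrite ffunE hc andbF.
Qed.

End Tableaux.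

Lemma sum_semistandard (R : comNzRingType) la N (w : 'I_N -> R) : is_partition la ->
  \sum_(T : {ffun cell la -> 'I_N} | semistandard T) \prod_c w (T c) =
  schur_eval la [seq w i | i <- enum 'I_N].
Proof.
move=> pla; have inla (c : cell la) : in_shape la c by exact: ltn_ord.
(* An empty alphabet has no default letter to put outside a shape, so it is treated separately. *)
case: N w => [|N] w.
  rewrite (_ : enum _ = [::]) /=; last by apply: size0nil; rewrite size_enum_ord.
  rewrite /schur_eval /= /delta_empty.
  have cd : #|[pred c : cell la | in_shape la c]| = sumn la by apply: card_in_shape.
  case: eqP => la0; last first.
    rewrite big1 // => T _; have : (0 < #|[pred c : cell la | in_shape la c]|)%N.
      by rewrite cd lt0n; apply/eqP.
    by case/card_gt0P => c _; case: (T c).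
  have noc (c : cell la) : False.
    by have /card0_eq/(_ c) : #|[pred c : cell la | in_shape la c]| = 0%N
      by [rewrite cd]; rewrite inE inla.
  pose T0 : {ffun cell la -> 'I_0} := [ffun c => match noc c with end].
  rewrite (big_pred1 T0) => [|T]; last first.
    transitivity true; first by apply/forallP => c; case: (noc c).
    by symmetry; apply/eqP/ffunP => c; case: (noc c).
  by rewrite big1 // => c; case: (noc c).
have := @sum_filling R la N.+1 ord0 w la N.+1 (leqnn _) erefl pla (fun=> leqnn _).
rewrite take_oversize ?size_enum_ord // => e.
rewrite -(perm_schur_eval la (permEl (perm_rev _))).
rewrite -e; apply: eq_big => [T|T _]; last first.
  by apply: eq_bigl => c; rewrite inla.
rewrite /filling /semistandard; symmetry.
rewrite [X in X && _](_ : _ = true) /=; last first.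
  by apply/forallP => c; rewrite inla ltn_ord.
by apply: eq_forallb => c; apply: eq_forallb => c'; rewrite !inla.
Qed.

Lemma schurE la N : is_partition la ->
  schur la N = schur_eval la [seq 'X_i | i <- enum 'I_N].
Proof. exact: sum_semistandard. Qed.

(** * Complete homogeneous functions and plethysm *)

(** Multisets are listed individually because a plethysm substitutes their products as separate
    letters. The inner recursion keeps the first letter available for repetition. *)
Fixpoint msets (T : Type) (L : seq T) : nat -> seq (seq T) :=
  if L is x :: L' then
    fix aux k := if k is k'.+1
                 then msets L' k'.+1 ++ [seq x :: s | s <- aux k'] else [:: [::]]
  else fun k => if k is 0 then [:: [::]] else [::].

Lemma msets0 (T : Type) (L : seq T) : msets L 0 = [:: [::]].
Proof. by case: L. Qed.

Lemma msetsS (T : Type) k x (L : seq T) :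
  msets (x :: L) k.+1 = msets L k.+1 ++ [seq x :: s | s <- msets (x :: L) k].
Proof. by []. Qed.

Lemma msets_map (T U : Type) (f : T -> U) L k :
  msets (map f L) k = map (map f) (msets L k).
Proof.
elim: L k => [|x L IHL]; first by case.
elim=> [|k IHk]; first by rewrite !msets0.
rewrite msetsS map_cat -IHL -!map_comp [map f _]/= msetsS IHk -map_comp.
by [].
Qed.

Section CompleteList.

Variable R : comNzRingType.
Implicit Types (x y u : R) (L : seq R).

(* The sum of this list is h_k(L). *)
Definition hlist k L : seq R := [seq \prod_(x <- s) x | s <- msets L k].

Lemma hlist0 L : hlist 0 L = [:: 1].
Proof. by rewrite /hlist msets0 /= big_nil. Qed.

Lemma hlistS k x L :
  hlist k.+1 (x :: L) = hlist k.+1 L ++ [seq x * y | y <- hlist k (x :: L)].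
Proof.
rewrite /hlist msetsS map_cat -!map_comp; congr (_ ++ _).
by apply: eq_map => s /=; rewrite big_cons.
Qed.

Lemma perm_hlist_cons k x L1 L2 : (forall j, perm_eq (hlist j L1) (hlist j L2)) ->
  perm_eq (hlist k (x :: L1)) (hlist k (x :: L2)).
Proof.
by move=> e; elim: k => [|k IHk]; rewrite ?hlist0 // !hlistS perm_cat // perm_map.
Qed.

(** Monomials are split into those with neither x nor y, with y only, with x only, and with both;
    this splitting is symmetric once the induction hypothesis handles the smaller degrees. *)
Lemma perm_hlist_swap k x y L :
  perm_eq (hlist k (x :: y :: L)) (hlist k (y :: x :: L)).
Proof.
elim/ltn_ind: k => -[|[|k]] IHk; first by rewrite !hlist0.
  by rewrite !hlistS !hlist0 -!catA perm_cat2l perm_catC.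
have e x' y' : (forall j, (j < k.+2)%N ->
     perm_eq (hlist j (x' :: y' :: L)) (hlist j (y' :: x' :: L))) ->
   perm_eq (hlist k.+2 (x' :: y' :: L))
   (hlist k.+2 L ++ [seq y' * z | z <- hlist k.+1 (y' :: L)] ++
    [seq x' * z | z <- hlist k.+1 (x' :: L)] ++
    [seq x' * y' * z | z <- hlist k (y' :: x' :: L)]).
  move=> h; rewrite 2!hlistS -!catA !perm_cat2l.
  apply: perm_trans (perm_map _ (h k.+1 (ltnSn _))) _.
  rewrite hlistS map_cat perm_cat2l -map_comp.
  by under eq_map => z do rewrite /= mulrA.
apply: perm_trans (e x y _) _; first exact: IHk.
rewrite perm_sym; apply: perm_trans (e y x _) _.
  by move=> j jk; rewrite perm_sym IHk.
rewrite perm_cat2l perm_catCA perm_cat2l perm_cat2l mulrC perm_map //.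
by rewrite IHk.
Qed.

Lemma perm_hlist_rot1 k L1 x L2 :
  perm_eq (hlist k (L1 ++ x :: L2)) (hlist k (x :: L1 ++ L2)).
Proof.
elim: L1 k => //= y L1 IHL k; apply: perm_trans (perm_hlist_swap k y x _).
exact: perm_hlist_cons.
Qed.

Lemma perm_hlist k L1 L2 : perm_eq L1 L2 -> perm_eq (hlist k L1) (hlist k L2).
Proof.
elim: L1 L2 k => [|x L1 IHL] L2 k.
  by rewrite perm_sym => /perm_nilP ->.
move=> e; have xL : x \in L2 by rewrite -(perm_mem e) mem_head.
case/splitPr: xL e => L3 L4; rewrite perm_sym perm_catC /= perm_cons perm_catC perm_sym.
move=> e; rewrite perm_sym; apply: perm_trans (perm_hlist_rot1 _ _ _ _) _.
by rewrite perm_sym; apply: perm_hlist_cons => j; apply: IHL.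
Qed.

Lemma perm_hlist_zeros k j L :
  exists i, perm_eq (hlist k (nseq j 0 ++ L)) (nseq i 0 ++ hlist k L).
Proof.
elim: j k => [|j IHj] k; first by exists 0%N.
case: k => [|k]; first by exists 0%N; rewrite !hlist0.
have [i hi] := IHj k.+1; exists (size (hlist k (nseq j.+1 0%R ++ L)) + i)%N.
rewrite /= hlistS perm_catC nseqD -catA.
set l := hlist k _; have -> : [seq 0 * y | y <- l] = nseq (size l) 0.
  by elim: l => //= y l ->; rewrite mul0r.
by rewrite perm_cat2l.
Qed.

Lemma peels_hlist_zeros phi k j u L la : is_partition la ->
  peels phi [seq u * y | y <- hlist k (nseq j 0 ++ L)] la =
  peels phi [seq u * y | y <- hlist k L] la.
Proof.
move=> pla; have [i hi] := perm_hlist_zeros k j L.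
rewrite (perm_peels _ (perm_map _ hi)) map_cat map_nseq mulr0.
exact: peels_zeros.
Qed.

Lemma schur_eval_row_cons k x L :
  schur_eval [:: k.+1] (x :: L) =
  schur_eval [:: k.+1] L + x * schur_eval [:: k] (x :: L).
Proof.
rewrite !schur_eval_cons !peel_cons /= big_nat_recr //=.
rewrite subnn mul1r peel_nil addrC big_distrr /=; congr (_ + _).
rewrite !big_nat; apply: eq_bigr => j /= jk.
by rewrite subSn // exprS mulrA.
Qed.

Lemma schur_eval_row k L : schur_eval [:: k] L = \sum_(x <- hlist k L) x.
Proof.
elim: L k => [|x L IHL] k.
  rewrite /schur_eval /= /delta_empty /= addn0; case: k => [|k].
    by rewrite hlist0 big_seq1.
  by rewrite big_nil.
elim: k => [|k IHk].
  rewrite hlist0 big_seq1 schur_eval_cons peel_cons big_mkcond big_nat1 peel_nil IHL.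
  by rewrite hlist0 big_seq1 mul1r.
rewrite schur_eval_row_cons IHL IHk hlistS big_cat big_distrr /=.
by congr (_ + _); rewrite [RHS]big_map.
Qed.

End CompleteList.

Lemma rmorph_hlist (R S : comNzRingType) (f : {rmorphism R -> S}) k L :
  map f (hlist k L) = hlist k (map f L).
Proof.
rewrite /hlist msets_map -!map_comp; apply: eq_map => s /=.
by rewrite rmorph_prod big_map.
Qed.

Section Plethysm.

Variable N : nat.

Lemma hlist_monomials m :
  exists W : seq 'X_{1..N}, hlist m [seq 'X_i : {mpoly int[N]} | i <- enum 'I_N] =
                            [seq 'X_[w] | w <- W].
Proof.
exists [seq (\sum_(i <- s) U_(i))%MM | s <- msets (enum 'I_N) m].
rewrite /hlist msets_map -!map_comp; apply: eq_map => s /=.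
by rewrite big_map mprodXE.
Qed.

(** h_m is the sum of a list W of monomials, so its coefficient at w counts w in W; reading the
    monomials back from the polynomial loses only their order. *)
Lemma perm_monomials m :
  perm_eq [seq 'X_[w] : {mpoly int[N]} | w <- monomials (schur [:: m] N)]
          (hlist m [seq 'X_i | i <- enum 'I_N]).
Proof.
rewrite schurE // schur_eval_row.
have [W ->] := hlist_monomials m; rewrite big_map perm_map //.
apply/allP => w _ /=; set p := \sum_(_ <- _) _.
have pw v : p@_v = (count_mem v W)%:R.
  rewrite /p raddf_sum /=; elim: (W) => [|v' W' IHW]; first by rewrite big_nil.
  by rewrite big_cons IHW mcoeffX natrD.
rewrite /monomials count_flatten -map_comp sumnE big_map.
under eq_bigr => v _ do rewrite /= count_nseq pw.
have [wp|wp] := boolP (w \in msupp p).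
  rewrite (bigD1_seq w) ?msupp_uniq //= eqxx mul1n big1 ?addn0 ?natz ?absz_nat //.
  by move=> v /negPf ->.
have w0 : count_mem w W = 0%N.
  by move: wp; rewrite mcoeff_msupp negbK pw natz => /eqP[].
rewrite w0 big_seq big1 //.
by move=> v vp; rewrite /= (_ : (v == w) = false) //; apply: contraNF wp => /eqP <-.
Qed.

Lemma schur_comp nu M (t : M.-tuple {mpoly int[N]}) : is_partition nu ->
  schur nu M \mPo t = schur_eval nu t.
Proof.
move=> pnu; rewrite schurE // rmorph_schur_eval -map_comp; congr schur_eval.
rewrite -[RHS](map_tnth_enum t); apply: eq_map => i /=.
by rewrite comp_mpolyXU -tnth_nth.
Qed.

Lemma plethysmE nu m : is_partition nu ->
  plethysm (schur nu) (schur [:: m]) N =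
  schur_eval nu (hlist m [seq 'X_i | i <- enum 'I_N]).
Proof.
move=> pnu; rewrite /plethysm schur_comp //=.
exact/perm_schur_eval/perm_monomials.
Qed.

End Plethysm.

(** * Existence of the Schur expansion *)

Lemma dhomog_hlist N (L : seq {mpoly int[N]}) k :
  {in L, forall x, x \is 1.-homog} -> {in hlist k L, forall y, y \is k.-homog}.
Proof.
elim: L k => [|x L IHL] [|k] hL y.
- by rewrite hlist0 inE => /eqP ->; apply: dhomog1.
- by [].
- by rewrite hlist0 inE => /eqP ->; apply: dhomog1.
have hL' : {in L, forall z, z \is 1.-homog}.
  by move=> z zL; apply: hL; rewrite inE zL orbT.
elim: k y => [|k IHk] y; rewrite hlistS mem_cat => /orP[/(IHL _ hL') //|/mapP[z]].
  rewrite hlist0 inE => /eqP -> ->; rewrite mulr1; apply: hL; exact: mem_head.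
move=> /IHk hz ->; rewrite -add1n; apply: dhomogM hz; apply: hL; exact: mem_head.
Qed.

Lemma dhomog_schur_eval N (L : seq {mpoly int[N]}) k la :
  {in L, forall x, x \is k.-homog} -> schur_eval la L \is (k * sumn la).-homog.
Proof.
elim: L la => [|x L IHL] la hL.
  rewrite /schur_eval /= /delta_empty; case: eqP => [->|_]; last exact: dhomog0.
  by rewrite muln0; apply: dhomog1.
rewrite schur_eval_cons /peel big_seq; apply: rpred_sum => mu hmu.
have -> : (k * sumn la = k * (sumn la - sumn mu) + k * sumn mu)%N.
  by rewrite -mulnDr subnK // hstrips_sumn.
apply: dhomogM; first by apply: dhomogMn; apply: hL; apply: mem_head.
by apply: IHL => z zL; apply: hL; rewrite inE zL orbT.
Qed.

(* s_nu o h_m in N variables *)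
Definition schur_h nu m N : {mpoly int[N]} :=
  schur_eval nu (hlist m [seq 'X_i | i <- enum 'I_N]).

Lemma dhomog_schur_h nu m N : schur_h nu m N \is (m * sumn nu).-homog.
Proof.
apply: dhomog_schur_eval; apply: dhomog_hlist => x /mapP[i _ ->].
by rewrite dhomogX /= mdeg1.
Qed.

Lemma perm_hlist1 (R : comNzRingType) (L : seq R) : perm_eq (hlist 1 L) L.
Proof.
elim: L => // x L IHL; rewrite hlistS hlist0 /= mulr1 cats1 perm_rcons.
by rewrite perm_cons.
Qed.

Lemma schur_schur_h la N : is_partition la -> schur la N = schur_h la 1 N.
Proof.
by move=> pla; rewrite schurE //; apply/esym/perm_schur_eval/perm_hlist1.
Qed.

(** * Restriction to the support of a monomial *)

Section Restriction.

Variables (N k : nat) (e : 'I_k -> 'I_N).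
Hypothesis inj_e : injective e.

Definition restr_var i : {mpoly int[k]} :=
  if [pick j | e j == i] is Some j then 'X_j else 0.

Definition restr : N.-tuple {mpoly int[k]} := [tuple restr_var i | i < N].

Definition outside := [seq i <- enum 'I_N | i \notin codom e].

Lemma restr_var_e j : restr_var (e j) = 'X_j.
Proof.
rewrite /restr_var; case: pickP => [j' /eqP/inj_e -> //|/(_ j)].
by rewrite eqxx.
Qed.

Lemma restr_var_out i : i \notin codom e -> restr_var i = 0.
Proof.
move=> hi; rewrite /restr_var; case: pickP => // j /eqP ij.
by rewrite -ij codom_f in hi.
Qed.

Lemma perm_outside : perm_eq (enum 'I_N) (outside ++ [seq e j | j <- enum 'I_k]).
Proof.
apply: uniq_perm; first exact: enum_uniq.
  rewrite cat_uniq filter_uniq ?enum_uniq //= map_inj_uniq // enum_uniq andbT.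
  apply/hasPn => i /mapP[j _ ->]; rewrite mem_filter negb_and negbK.
  by rewrite codom_f.
move=> i; rewrite mem_cat mem_enum /outside mem_filter mem_enum andbT.
by rewrite [X in _ || X](_ : _ = (i \in codom e)) ?orNb.
Qed.

Lemma restr_schur_h nu m : is_partition nu ->
  schur_h nu m N \mPo restr = schur_h nu m k.
Proof.
move=> pnu; rewrite /schur_h rmorph_schur_eval rmorph_hlist -map_comp.
rewrite (_ : map _ _ = map restr_var (enum 'I_N)); last first.
  by apply: eq_map => i /=; rewrite comp_mpolyXU -tnth_nth tnth_mktuple.
rewrite (perm_schur_eval _ (perm_hlist m (perm_map _ perm_outside))) map_cat.
have -> : map restr_var outside = nseq (size outside) 0.
  rewrite /outside; elim: (enum 'I_N) => //= i s; case: ifP => //= hi ->.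
  by rewrite restr_var_out.
rewrite -map_comp (eq_map restr_var_e).
have := @peels_hlist_zeros _ delta_empty m (size outside) 1
  [seq 'X_i : {mpoly int[k]} | i <- enum 'I_k] nu pnu.
by rewrite !(eq_map (fun y => mul1r y)) !map_id.
Qed.

Lemma restr_monomial w :
  'X_[w] \mPo restr =
  if all (fun i => w i == 0%N) outside then 'X_[[multinom w (e j) | j < k]] else 0.
Proof.
rewrite comp_mpolyX; under eq_bigr do rewrite tnth_mktuple.
rewrite -[index_enum _]enumT -[X in \prod_(i <- X) _]/(enum 'I_N).
rewrite (perm_big _ perm_outside) big_cat /=.
have -> : \prod_(i <- [seq e j | j <- enum 'I_k]) restr_var i ^+ w i =
          'X_[[multinom w (e j) | j < k]].
  rewrite mpolyXE_id big_map big_enum; apply: eq_bigr => j _.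
  by rewrite restr_var_e mnmE.
have : {subset outside <= [predC codom e]}.
  by move=> i; rewrite mem_filter => /andP[].
elim: outside => [|i s IHs] hs; first by rewrite big_nil mul1r.
rewrite big_cons /= restr_var_out; last by apply: hs; apply: mem_head.
rewrite expr0n; case: eqP => _ /=; last by rewrite !mul0r.
by rewrite mul1r IHs // => i' hi'; apply: hs; rewrite inE hi' orbT.
Qed.

Lemma mcoeff_restr p (w : 'X_{1..N}) : {in outside, forall i, w i = 0%N} ->
  (p \mPo restr)@_[multinom w (e j) | j < k] = p@_w.
Proof.
move=> hw; rewrite comp_mpolyEX [in RHS](mpolyE p) !raddf_sum /=.
apply: eq_bigr => v _; rewrite !mcoeffZ restr_monomial mcoeffX; congr (_ * _).
case: allP => hv; last first.
  rewrite mcoeff0; case: eqP => // evw; case: hv => i hi.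
  by rewrite evw hw.
rewrite mcoeffX; congr (nat_of_bool _)%:R; apply/eqP/eqP => [h|-> //].
apply/mnmP => i; have [|] := boolP (i \in codom e).
  by case/codomP => j ->; have /mnmP/(_ j) := h; rewrite !mnmE.
by move=> hi; rewrite hw ?(eqP (hv i _)) // mem_filter hi mem_enum.
Qed.

End Restriction.

Definition part_mnm mu : 'X_{1..size mu} := [multinom nth 0%N mu j | j < size mu].

(** Symmetry and stability together: the variables of w with nonzero exponent are listed by
    decreasing exponent and the others set to zero. As mu does not depend on nu and m, an identity
    between such functions for all N reduces to finitely many coefficients. *)
Lemma mcoeff_part_mnm N (w : 'X_{1..N}) :
  exists2 mu, mu \in partitions (mdeg w) &
    forall nu m, is_partition nu ->
      (schur_h nu m N)@_w = (schur_h nu m (size mu))@_(part_mnm mu).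
Proof.
pose s := sort (fun i j => w j <= w i)%N [seq i <- enum 'I_N | w i != 0%N].
have us : uniq s by rewrite sort_uniq filter_uniq ?enum_uniq.
have ms i : (i \in s) = (w i != 0%N) by rewrite mem_sort mem_filter mem_enum andbT.
pose mu := [seq w i | i <- s].
have sz : size mu = size s by rewrite size_map.
pose e (j : 'I_(size mu)) := tnth (in_tuple s) (cast_ord sz j).
have ee j : e j = tnth (in_tuple s) (cast_ord sz j) by [].
have inj_e : injective e.
  have /tuple_uniqP inj_s : uniq (in_tuple s) by [].
  by move=> j1 j2 /inj_s /cast_ord_inj.
have hw : {in outside e, forall i, w i = 0%N}.
  move=> i; rewrite mem_filter => /andP[hi _]; apply/eqP; apply: contraNT hi => wi.
  have /(tnthP (in_tuple s))[j ->] : i \in in_tuple s by rewrite ms.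
  by apply/codomP; exists (cast_ord (esym sz) j); rewrite ee cast_ordKV.
exists mu.
  rewrite mem_partitions; apply/and3P; split.
  - rewrite /mu /is_partition sorted_map; apply: sort_sorted => i j; exact: leq_total.
  - by apply/mapP => -[i]; rewrite ms => /eqP + /esym.
  - rewrite mdegE sumnE big_map (perm_big _ (permEl (perm_sort _ _))) big_filter.
    rewrite big_mkcond big_enum; apply/eqP; apply: eq_bigr => i _.
    by case: eqP.
move=> nu m pnu; rewrite -(mcoeff_restr inj_e _ hw) restr_schur_h //.
congr mcoeff; apply/mnmP => j; rewrite !mnmE ee (tnth_nth (e j)) /=.
by rewrite (nth_map (e j)) // -sz.
Qed.

(** * Kostka numbers and their triangularity *)

Lemma mcoeff_XnM N (p : {mpoly int[N]}) i k w :
  ('X_i ^+ k * p)@_w = if (k <= w i)%N then p@_(w - U_(i) *+ k) else 0.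
Proof.
rewrite mpolyXn; case: leqP => kw.
  have {1}-> : w = (U_(i) *+ k + (w - U_(i) *+ k))%MM.
    apply/mnmP => j; rewrite mnmDE mnmBE mulmnE mnm1E.
    by case: eqP => [<-|_]; rewrite ?mul1n ?subnKC.
  by rewrite mulrC mcoeffMX.
rewrite [p]mpolyE mulr_sumr raddf_sum big1 // => v _ /=.
rewrite -scalerAr -mpolyXD mcoeffZ mcoeffX; case: eqP => [e|]; last by rewrite mulr0.
by move: kw; rewrite -e mnmDE mulmnE mnm1E eqxx mul1n ltnNge leq_addr.
Qed.

(* The number of semistandard tableaux of shape la and content al, the largest *)
(* letter being the first entry of al.                                         *)
Fixpoint kostka (al la : seq nat) : nat :=
  if al is a :: al' then
    \sum_(mu <- hstrips la | (sumn la - sumn mu == a)%N) kostka al' mu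
  else (sumn la == 0)%N.

Lemma mcoeff_schur_eval N (s : seq 'I_N) la w : uniq s ->
  (schur_eval la [seq 'X_i : {mpoly int[N]} | i <- s])@_w =
  if [forall i, (i \in s) || (w i == 0%N)]
  then (kostka [seq w i | i <- s] la)%:R else 0.
Proof.
elim: s la w => [|i s IHs] la w /=.
  move=> _; rewrite /schur_eval /= /delta_empty -mpolyC_nat mcoeffC natz mulr_natr.
  case: forallP => h.
    rewrite (_ : w = 0%MM) ?eqxx ?mulr1n //.
    by apply/mnmP => i; rewrite mnm0E; apply/eqP; exact: h.
  by case: (w =P 0%MM) => // e; case: h => i; rewrite e mnm0E eqxx.
case/andP => si us; rewrite /peel raddf_sum /=.
have sup mu k : (k <= w i)%N ->
   (schur_eval mu [seq 'X_i : {mpoly int[N]} | i <- s])@_(w - U_(i) *+ k) =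
   if [forall j, (j \in i :: s) || (w j == 0%N)] && (k == w i)
   then (kostka [seq w j | j <- s] mu)%:R else 0.
  move=> ki; rewrite IHs //.
  have wj j : j != i -> (w - U_(i) *+ k)%MM j = w j.
    by move=> ji; rewrite mnmBE mulmnE mnm1E eq_sym (negPf ji) subn0.
  have wi : (w - U_(i) *+ k)%MM i = (w i - k)%N.
    by rewrite mnmBE mulmnE mnm1E eqxx mul1n.
  have -> : [seq (w - U_(i) *+ k)%MM j | j <- s] = [seq w j | j <- s].
    apply/eq_in_map => j js; apply: wj.
    by apply: contraTneq js => ->.
  congr (if _ then _ else _).
  apply/forallP/andP => [h|[/forallP h /eqP ek] j].
    split; last by have := h i; rewrite (negPf si) wi /= subn_eq0 eqn_leq ki.
    apply/forallP => j; rewrite inE; case: eqVneq => //= ji.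
    by have := h j; rewrite wj.
  have [->|ji] := eqVneq j i; first by rewrite wi ek subnn orbT.
  by have := h j; rewrite inE (negPf ji) wj.
rewrite natr_sum.
under eq_bigr => mu _ do rewrite mcoeff_XnM.
transitivity (\sum_(mu <- hstrips la) if
   [forall j, (j \in i :: s) || (w j == 0%N)] && (sumn la - sumn mu == w i)%N
   then (kostka [seq w j | j <- s] mu)%:R else 0 : int).
  apply: eq_bigr => mu _; case: leqP => l; first exact: sup.
  by case: eqP => [e|]; rewrite ?andbF //; move: l; rewrite e ltnn.
case: ifP => _ /=; last by rewrite big1.
by rewrite [RHS]big_mkcond.
Qed.

Lemma hstripsE a t :
  hstrips (a :: t) =
  [seq j :: u | j <- [seq j <- index_iota 0 a.+1 | head 0 t <= j]%N, u <- hstrips t].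
Proof. by []. Qed.

Lemma hstrips_rcons0 la :
  hstrips (rcons la 0%N) = [seq rcons mu 0%N | mu <- hstrips la].
Proof.
elim: la => // a t IHt; rewrite rcons_cons !hstripsE IHt.
have -> : head 0%N (rcons t 0%N) = head 0%N t by case: t {IHt}.
by rewrite allpairs_mapr map_allpairs.
Qed.

Lemma kostka_rcons0 al la : kostka al (rcons la 0%N) = kostka al la.
Proof.
elim: al la => [|a al IHal] la /=; first by rewrite sumn_rcons addn0.
rewrite hstrips_rcons0 big_map; apply: eq_big => [mu|mu _]; last exact: IHal.
by rewrite !sumn_rcons !addn0.
Qed.

(** A horizontal strip has at most one cell in each of the a columns, and it meets all of them only
    when each row is cut down to the length of the next. *)
Lemma sumn_hstrips_head a t mu : mu \in hstrips (a :: t) ->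
  (a + sumn t - sumn mu <= a ?= iff (mu == rcons t 0))%N.
Proof.
elim: t a mu => [|b t IHt] a [|j u]; rewrite ?nil_hstrips // hstrips_cons /=.
  case: u => [|j' u] /andP[ja] // _; rewrite !addn0; apply/leqifP; rewrite eqseq_cons andbT.
  case: eqP => [->|j0]; first by rewrite subn0.
  lia.
case/andP=> /andP[bj ja] hu; have /leqifP := IHt b u hu; rewrite eqseq_cons.
have := hstrips_sumn hu => /=.
case: (u == _) => h1 h2; apply/leqifP; last by rewrite andbF; lia.
rewrite andbT; case: eqP; lia.
Qed.

Lemma rcons0_hstrips a t : is_partition (a :: t) -> rcons t 0%N \in hstrips (a :: t).
Proof.
elim: t a => [|b t IHt] a; first by rewrite hstrips_cons.
by case/andP=> ba /IHt h; rewrite hstrips_cons leqnn h andbT.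
Qed.

Lemma kostka_head_gt b al la : (head 0 la < b)%N -> kostka (b :: al) la = 0%N.
Proof.
case: la => [|a t] /= ab.
  by rewrite big_mkcond big_seq1; case: eqP => // e; move: ab; rewrite -e.
rewrite big_seq_cond big1 // => mu /andP[/sumn_hstrips_head[h _] /eqP e].
by move: ab; rewrite -e ltnNge h.
Qed.

Lemma kostka_head a al t : is_partition (a :: t) ->
  kostka (a :: al) (a :: t) = kostka al t.
Proof.
move=> pat; rewrite /= big_mkcond (bigD1_seq (rcons t 0%N)) ?hstrips_uniq //=; last first.
  exact: rcons0_hstrips.
rewrite sumn_rcons addn0 addnK eqxx kostka_rcons0 big_seq_cond big1 ?addn0 // => mu.
case/andP=> hmu ne; case: eqP => // e.
by have [_] := sumn_hstrips_head hmu; rewrite e eqxx (negPf ne).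
Qed.

Lemma kostka_diag la : is_partition la -> kostka la la = 1%N.
Proof.
elim: la => // a t IHt pat; rewrite kostka_head // IHt //.
exact: path_sorted pat.
Qed.

(** At the first difference the content asks for a strip longer than the first row of the shape;
    before it, equal entries force the whole first row off ([kostka_head]). *)
Lemma kostka_lex la mu : is_partition la -> 0%N \notin mu ->
  ((la : seqlexi nat) < (mu : seqlexi nat))%O -> kostka mu la = 0%N.
Proof.
elim: mu la => [|b mu IHmu] [|a la] // pla.
  rewrite inE negb_or => /andP[b0 _] _; apply: kostka_head_gt.
  by rewrite /= lt0n eq_sym.
rewrite inE negb_or => /andP[_ mu0]; rewrite Order.SeqLexiOrder.Exports.ltxi_cons !leEnat.
case/andP; rewrite leq_eqVlt => /orP[/eqP eab|lt _]; last exact: kostka_head_gt.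
rewrite -eab leqnn implyTb => lt; rewrite kostka_head //.
by apply: IHmu lt => //; apply: path_sorted pla.
Qed.

(** Back substitution: the unknown at the head is absent from the equations of the tail, so these
    are solved first and the equation at the head then fixes it. *)
Lemma triangular_solve (T : eqType) (s : seq T) (K : T -> T -> int) (F : T -> int) :
  uniq s -> {in s, forall x, K x x = 1} -> pairwise (fun x y => K x y == 0) s ->
  exists c : T -> int, {in s, forall y, F y = \sum_(x <- s) c x * K x y}.
Proof.
elim: s => [|x s IHs] /=; first by exists (fun=> 0).
case/andP=> xs us K1 /andP[/allP Kx Ks].
have [|c hc] := IHs us _ Ks; first by move=> y ys; apply: K1; rewrite inE ys orbT.
pose cx := F x - \sum_(z <- s) c z * K z x.
exists (fun z => if z == x then cx else c z) => y.
have sumE : \sum_(z <- s) (if z == x then cx else c z) * K z y =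
            \sum_(z <- s) c z * K z y.
  by apply: eq_big_seq => z zs; case: eqP => // e; rewrite -e zs in xs.
rewrite big_cons eqxx sumE inE => /predU1P[->|ys].
  by rewrite K1 ?mem_head // mulr1 subrK.
by rewrite (eqP (Kx y ys)) mulr0 add0r hc.
Qed.

Lemma partition_mem d la : la \in partitions d -> is_partition la.
Proof. by rewrite mem_partitions => /and3P[]. Qed.

Lemma mcoeff_schur_part_mnm la mu :
  (schur_h la 1 (size mu))@_(part_mnm mu) = (kostka mu la)%:R.
Proof.
rewrite /schur_h (perm_schur_eval _ (perm_hlist1 _)) mcoeff_schur_eval ?enum_uniq //.
rewrite (_ : [forall i, _]) => [|]; last by apply/forallP => i; rewrite mem_enum.
congr (kostka _ _)%:R; apply: (@eq_from_nth _ 0%N) => [|i].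
  by rewrite size_map size_enum_ord.
rewrite size_map size_enum_ord => il.
rewrite (nth_map (Ordinal il)) ?size_enum_ord // mnmE.
by rewrite nth_enum_ord.
Qed.

(** The coefficients solve the unitriangular Kostka system at the monomials [part_mnm mu];
    homogeneity and [mcoeff_part_mnm] extend the identity to all monomials and all N. *)
Lemma schur_expansion_exists nu m : is_partition nu ->
  exists c, schur_expansion (m * sumn nu) (schur_h nu m) c.
Proof.
move=> pnu; set d := (m * sumn nu)%N.
pose s : seq (seqlexi nat) := sort <=%O (partitions d : seq (seqlexi nat)).
have ps : perm_eq s (partitions d) by rewrite perm_sort.
have us : uniq s by rewrite (perm_uniq ps) partitions_uniq.
have [| |c hc] := @triangular_solve _ s
    (fun la mu => (kostka mu la)%:R)
    (fun mu => (schur_h nu m (size mu))@_(part_mnm mu)) us.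
- by move=> mu; rewrite (perm_mem ps) => /partition_mem/kostka_diag ->.
- have : pairwise <%O s.
    by rewrite -sorted_pairwise; [rewrite sort_lt_sorted partitions_uniq | exact: lt_trans].
  apply: (@sub_in_pairwise _ (mem s)); last exact/allP.
  move=> la mu; rewrite !(perm_mem ps) !mem_partitions.
  by case/and3P=> pla _ _ /and3P[_ mu0 _] lt; rewrite (kostka_lex pla mu0 lt).
exists c => N; rewrite -(perm_big _ ps) /=; apply/mpolyP => w.
rewrite raddf_sum /=; have [wd|wd] := eqVneq (mdeg w) d; last first.
  rewrite (dhomog_nemf_coeff (dhomog_schur_h _ _ _) wd) big_seq big1 // => la.
  rewrite (perm_mem ps) mem_partitions => /and3P[pla _ /eqP lad].
  rewrite mcoeffZ schur_schur_h // (dhomog_nemf_coeff (dhomog_schur_h _ _ _)) ?mulr0 //.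
  by rewrite mul1n lad.
have [mu] := mcoeff_part_mnm w; rewrite wd => hmu E; rewrite E //.
rewrite hc ?(perm_mem ps) //; apply: eq_big_seq => la.
rewrite (perm_mem ps) => /partition_mem pla.
by rewrite mcoeffZ schur_schur_h // E // mcoeff_schur_part_mnm.
Qed.

(** * Hook coefficients: one odd letter *)

Lemma schur_expansion_eval (R : comNzRingType) (L : seq R) nu m d c :
  schur_expansion d (schur_h nu m) c ->
  schur_eval nu (hlist m L) =
  \sum_(la <- partitions d) (c la)%:~R * schur_eval la L.
Proof.
move=> /(_ (size L)) /(congr1 (mmap (intmul (1 : R)) (nth 0 L))).
have varE : map (mmap (intmul (1 : R)) (nth 0 L))
    [seq 'X_i : {mpoly int[size L]} | i <- enum 'I_(size L)] = L.
  rewrite -map_comp -[RHS](mkseq_nth 0) /mkseq -val_enum_ord -map_comp.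
  by apply: eq_map => i /=; rewrite mmapX mmap1U.
rewrite /schur_h rmorph_schur_eval rmorph_hlist varE => ->.
rewrite rmorph_sum; apply: eq_big_seq => la /partition_mem pla /=.
by rewrite mmapZ schurE // rmorph_schur_eval varE.
Qed.

(** * Alphabets built from roots of unity *)

Section RootsOfUnity.

Variables (A : idomainType) (z : A) (p : nat).
Hypotheses (zp : z ^+ p.+1 = 1) (z_neq1 : forall i, (0 < i <= p)%N -> z ^+ i != 1).
Implicit Types (s u : A) (P Q : {poly A}).

(** The substitution multiplies the coefficient of X^i by z^i, which differs from 1 for 0 < i <=
    p. *)
Lemma comp_scale_fixed P : (size P <= p.+1)%N -> P \Po (z *: 'X) = P -> P = (P`_0)%:P.
Proof.
move=> szP fixP; apply/polyP => i; rewrite coefC; case: eqP => [-> //|/eqP i0].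
have [ip|ip] := ltnP p i; first by rewrite nth_default // (leq_trans szP).
have : z ^+ i * P`_i = P`_i.
  rewrite -[in RHS]fixP comp_polyE coef_sum.
  under eq_bigr => j _ do rewrite exprZn scalerA coefZ coefXn.
  have [il|il] := ltnP i (size P).
    rewrite (bigD1 (Ordinal il)) //= eqxx mulr1 big1 ?addr0; first by rewrite mulrC.
    move=> j; by rewrite -val_eqE eq_sym => /negPf /= ->; rewrite mulr0.
  rewrite big1 ?nth_default ?mulr0 // => j _.
  by rewrite (gtn_eqF (leq_trans (ltn_ord j) il)) mulr0.
move/eqP; rewrite -subr_eq0 -{2}[P`_i]mul1r -mulrBl mulf_eq0 subr_eq0.
by rewrite (negPf (z_neq1 _)) /= ?lt0n ?i0 // => /eqP.
Qed.

Lemma size_mulS P Q i j :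
  (size P <= i.+1)%N -> (size Q <= j.+1)%N -> (size (P * Q)%R <= (i + j).+1)%N.
Proof. by move=> hP hQ; apply: leq_trans (size_polyMleq _ _) _; lia. Qed.

Lemma size_hlist (L : seq {poly A}) k :
  {in L, forall x : {poly A}, (size x <= 2)%N} ->
  {in hlist k L, forall y : {poly A}, (size y <= k.+1)%N}.
Proof.
elim: L k => [|x L IHL] k hL y.
  by case: k => // ; rewrite hlist0 inE => /eqP ->; rewrite size_poly1.
have hL' : {in L, forall y : {poly A}, (size y <= 2)%N}.
  by move=> w wL; apply: hL; rewrite inE wL orbT.
elim: k y => [|k IHk] y.
  by rewrite hlist0 inE => /eqP ->; rewrite size_poly1.
rewrite hlistS mem_cat => /orP[/(IHL _ hL') //|/mapP[w /IHk sw ->]].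
by apply: (@size_mulS x w 1 k) sw; apply: hL; apply: mem_head.
Qed.

Lemma size_peels (L : seq {poly A}) k (phi : seq nat -> {poly A}) la :
  {in L, forall x : {poly A}, (size x <= k.+1)%N} -> (forall mu, size (phi mu) <= 1)%N ->
  (size (peels phi L la) <= (k * sumn la).+1)%N.
Proof.
move=> + hphi; elim: L la => [|x L IHL] la hL /=.
  by apply: leq_trans (hphi la) _.
rewrite /peel big_seq; apply: (big_ind (fun q : {poly A} => size q <= (k * sumn la).+1)%N).
- by rewrite size_poly0.
- by move=> P Q hP hQ; apply: leq_trans (size_polyD _ _) _; rewrite geq_max hP.
move=> mu /hstrips_sumn hmu.
have -> : (k * sumn la = k * (sumn la - sumn mu) + k * sumn mu)%N.
  by rewrite -mulnDr subnK.
apply: size_mulS; last by apply: IHL => y yL; apply: hL; rewrite inE yL orbT.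
elim: (sumn la - sumn mu)%N => [|e IHe]; first by rewrite expr0 size_poly1.
by rewrite exprS mulnS; apply: size_mulS IHe; apply: hL; apply: mem_head.
Qed.

(* The left side is a polynomial in s of degree at most k |la| < p + 1 which   *)
(* is invariant under s -> z s, so it equals its value at s = 0.               *)
Lemma peels_roots phi k u s la : is_partition la -> (k * sumn la <= p)%N ->
  peels phi [seq u * y | y <- hlist k (1 :: [seq s * z ^+ i | i <- iota 0 p.+1])] la =
  peel u phi la.
Proof.
move=> pla kp.
pose L := (1 : {poly A}) :: [seq 'X * (z ^+ i)%:P | i <- iota 0 p.+1].
pose P := peels (polyC \o phi) [seq u%:P * y | y <- hlist k L] la.
have evP (f : {rmorphism {poly A} -> A}) : (forall a, f a%:P = a) ->
    f P = peels phi
      [seq u * y | y <- hlist k (1 :: [seq f 'X * z ^+ i | i <- iota 0 p.+1])] la.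
  move=> fC; rewrite /P rmorph_peels -map_comp.
  rewrite (eq_peels (psi := phi)); last by move=> mu /=; rewrite fC.
  congr peels; rewrite (eq_map (g := (fun y => u * y) \o f)); last first.
    by move=> y /=; rewrite rmorphM fC.
  rewrite map_comp rmorph_hlist /L map_cons rmorph1 -(map_comp f).
  congr (map _ (hlist _ (_ :: _))); apply: eq_map => i.
  by rewrite [LHS]rmorphM fC.
(* The substitution shifts the letters X z^i cyclically, the cycle closing because z^(p+1) = 1. *)
have fixP : P \Po (z *: 'X) = P.
  rewrite /P rmorph_peels -map_comp.
  rewrite (eq_peels (psi := polyC \o phi)); last by move=> mu /=; rewrite comp_polyC.
  rewrite (eq_map (g := (fun y => u%:P * y) \o comp_poly (z *: 'X))); last first.
    by move=> y /=; rewrite rmorphM /= comp_polyC.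
  rewrite map_comp rmorph_hlist; apply: perm_peels; apply: perm_map; apply: perm_hlist.
  rewrite /L map_cons rmorph1 perm_cons -map_comp.
  rewrite [X in perm_eq X _](eq_map (g := fun i => 'X * (z ^+ i.+1)%:P)); last first.
    by move=> i /=; rewrite comp_polyM comp_polyC comp_polyX exprS -mul_polyC rmorphM /=; ring.
  have -> : [seq 'X * (z ^+ i)%:P | i <- iota 0 p.+1] =
            'X * (z ^+ p.+1)%:P :: [seq 'X * (z ^+ i)%:P | i <- iota 1 p].
    by rewrite zp.
  rewrite -[X in iota 0 X]addn1 iotaD map_cat /= cats1 perm_rcons perm_cons.
  by rewrite (iotaDl 1 0) -map_comp.
have szP : (size P <= p.+1)%N.
  apply: leq_trans (@size_peels _ k _ _ _ _) _; last by rewrite ltnS.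
    move=> y /mapP[w hw ->]; rewrite -[k]add0n; apply: size_mulS.
      by rewrite size_polyC; case: (_ == _).
    apply: size_hlist hw => x; rewrite inE => /predU1P[->|/mapP[i _ ->]].
      by rewrite size_poly1.
    apply: (@size_mulS _ _ 1 0); rewrite ?size_polyX //.
    by rewrite size_polyC; case: (_ == _).
  by move=> mu; rewrite /= size_polyC; case: (_ == _).
have PE := comp_scale_fixed szP fixP.
transitivity (horner_eval s P).
  by rewrite evP /= ?/horner_eval ?hornerX // => a; rewrite hornerC.
transitivity (horner_eval 0 P).
  by rewrite PE /horner_eval !hornerC.
rewrite evP; last by move=> a; apply: hornerC.
have -> : [seq horner_eval (0 : A) 'X * z ^+ i | i <- iota 0 p.+1] = nseq p.+1 0.
  rewrite -[in RHS](size_iota 0 p.+1); elim: (iota _ _) => //= i l ->.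
  by rewrite /horner_eval hornerX mul0r.
rewrite (perm_peels _ (perm_map _ (perm_hlist _ (_ : perm_eq _ (nseq p.+1 0 ++ [:: 1]))))).
  rewrite peels_hlist_zeros //.
  suff -> : hlist k [:: (1 : A)] = [:: 1] by rewrite /= mulr1.
  by elim: k {kp P evP fixP szP PE} => [|k IHk]; rewrite ?hlist0 // hlistS IHk /= mulr1.
by rewrite -cat1s perm_catC.
Qed.

(** Let U be the letters s z^i with 0 < i <= p. The monomials of degree m in 1, s, U are those in 1,
    U and s times those of degree m - 1 in 1, s, U. By [peels_roots] the whole list acts as the
    letter 1 and the multiples of s act as the letter s. So the monomials in 1, U behave as the
    formal difference 1 - s, whatever m is. *)
Lemma peel_hlist_roots m s la : is_partition la -> (0 < m)%N -> (m * sumn la <= p)%N ->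
  peel s (fun mu => schur_eval mu (hlist m (1 :: [seq s * z ^+ i | i <- iota 1 p]))) la =
  peel 1 delta_empty la.
Proof.
case: m => // m pla _ mp; set U := map _ _.
have FE : [seq s * z ^+ i | i <- iota 0 p.+1] = s :: U by rewrite /= mulr1.
have mp' : (m * sumn la <= p)%N by apply: leq_trans mp; rewrite leq_mul2r leqnSn orbT.
rewrite -(peels_roots _ s s pla mp') FE -(peels_roots _ 1 s pla mp) FE.
rewrite [X in _ = peels _ X _](eq_map (g := id)) ?map_id => [|y]; last by rewrite mul1r.
have sw j : perm_eq (hlist j (1 :: s :: U)) (hlist j (s :: 1 :: U)).
  exact: perm_hlist_swap.
rewrite [RHS](perm_peels _ (sw _)) [in RHS]hlistS.
have e : perm_eq (hlist m.+1 (1 :: U) ++ [seq s * y | y <- hlist m (s :: 1 :: U)])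
                 ([seq s * y | y <- hlist m (1 :: s :: U)] ++ hlist m.+1 (1 :: U)).
  by rewrite perm_catC perm_cat2r perm_map // perm_sym sw.
by rewrite (perm_peels _ e) peels_cat.
Qed.

End RootsOfUnity.

Lemma partition_head0 a v : is_partition (a :: v) -> a = 0%N -> sumn (a :: v) = 0%N.
Proof.
move=> pav a0.
have : all (pred1 0%N) v.
  apply/allP => x xv; have := allP (order_path_min geq_transitive pav) x xv.
  by rewrite /= a0 leqn0.
by move/all_pred1P => e; rewrite e /= sumn_nseq a0.
Qed.

Section Hooks.

Variable R : comNzRingType.
Implicit Types (t : R) (la : seq nat).

(* s_la(1 | t), with one even letter 1 and one odd letter t *)
Definition super_eval t la : R :=
  if la is a :: v then
    if a == 0%N then 1 else (all (leq^~ 1%N) v)%:R * t ^+ sumn v * (1 + t)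
  else 1.

Lemma peel_sumn0 x (phi : seq nat -> R) la :
  is_partition la -> sumn la = 0%N -> peel x phi la = phi la.
Proof.
move=> pla la0; rewrite /peel (bigD1_seq la) ?hstrips_refl ?hstrips_uniq //=.
rewrite subnn mul1r big_seq_cond big1 ?addr0 // => mu /andP[hmu ne].
have := hstrips_sumn hmu; rewrite la0 leqn0 => /eqP mu0.
by rewrite (hstrips_full hmu) ?eqxx ?la0 // in ne.
Qed.

(** The function peeled is s_mu at a single odd letter t, which the even letter - t cancels: in a
    nonzero first row the choices 0 and 1 contribute opposite terms. *)
Lemma peel_column t la :
  peel (- t) (fun mu => (all (leq^~ 1%N) mu)%:R * t ^+ sumn mu) la = (sumn la == 0%N)%:R.
Proof.
elim: la => [|b w IHw]; first by rewrite peel_nil mul1r.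
rewrite peel_cons.
have E j : peel (- t) (fun u => (all (leq^~ 1%N) (j :: u))%:R * t ^+ sumn (j :: u)) w =
    (j <= 1)%N%:R * t ^+ j * (sumn w == 0%N)%:R.
  rewrite -IHw -peelZ; apply: eq_peel => mu /=.
  by rewrite exprD -mulnb natrM; ring.
under eq_bigr => j _ do rewrite E.
rewrite /= addn_eq0; case: eqP => [w0|_]; last first.
  by rewrite andbF big1 // => j _; rewrite !mulr0.
have -> : head 0%N w = 0%N by case: w w0 {IHw E} => //= a w; lia.
case: b => [|b] /=; first by rewrite big_nat1 !mulr1.
rewrite big_nat_recl // big_nat_recl //= big1_seq => [|j _]; last by rewrite !mul0r mulr0.
by rewrite subn0 subSS subn0 exprS expr1; ring.
Qed.

Lemma head_gt0 la : is_partition la -> sumn la != 0%N -> (0 < head 0 la)%N.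
Proof.
case: la => // b w pbw; rewrite lt0n; apply: contraNneq => b0.
by rewrite (partition_head0 pbw b0).
Qed.

Lemma peel_delta (x : R) b w : is_partition (b :: w) ->
  peel x delta_empty (b :: w) = (sumn w == 0%N)%:R * x ^+ b.
Proof.
move=> pbw; have pw : is_partition w by apply: path_sorted pbw.
rewrite peel_cons; have [w0|w0] := eqVneq (sumn w) 0%N.
  have -> : head 0%N w = 0%N by case: (w) w0 => //= ? ?; lia.
  under eq_bigr do rewrite peel_sumn0 // /delta_empty /= w0 addn0.
  rewrite big_nat_recl //= big1 => [|i _]; last by rewrite mulr0.
  by rewrite subn0 mulr1 addr0 mul1r.
rewrite mul0r big1 // => j hj.
have -> : peel x (fun u => delta_empty (j :: u)) w = peel x (fun=> 0 * (0 : R)) w.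
  apply: eq_peel => u; rewrite /delta_empty /= addn_eq0 mulr0.
  by rewrite gtn_eqF // (leq_trans (head_gt0 pw w0)).
by rewrite (peelZ x 0 (fun=> 0)) mul0r mulr0.
Qed.

(** The letter - t cancels the odd letter and leaves the even letter 1, the same outcome as in
    [peel_hlist_roots] with s = - t. *)
Lemma peel_super_eval t la : is_partition la ->
  peel (- t) (super_eval t) la = peel 1 delta_empty la.
Proof.
case: la => [|a v] pav; first by rewrite !peel_nil.
have pv : is_partition v by apply: path_sorted pav.
rewrite peel_delta // expr1n mulr1 peel_cons.
have [v0|v0] := eqVneq (sumn v) 0%N.
  have -> : head 0%N v = 0%N by case: (v) v0 => //= ? ?; lia.
  under eq_bigr do rewrite peel_sumn0 //.
  have allv : all (leq^~ 1%N) v.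
    by apply/allP => x /mem_le_sumn; rewrite v0; case: x.
  rewrite [RHS](_ : _ = 1) //; elim: a {pav} => [|a IHa]; first by rewrite big_nat1 mulr1.
  rewrite big_nat_recr //= subnn allv v0 !mul1r.
  rewrite (_ : \sum_(0 <= j < a.+1) _ = - t); first by ring.
  rewrite -[RHS]mulr1 -[in RHS]IHa big_distrr /= !big_nat; apply: eq_bigr => j hj.
  have -> : (a.+1 - j = (a - j).+1)%N by [lia].
  by rewrite exprS mulrA allv v0 !mul1r.
rewrite big1 // => j hj.
have j0 : j != 0%N by rewrite -lt0n (leq_trans (head_gt0 pv v0)).
have -> : peel (- t) (fun u => super_eval t (j :: u)) v =
          (1 + t) * peel (- t) (fun u => (all (leq^~ 1%N) u)%:R * t ^+ sumn u) v.
  by rewrite -peelZ; apply: eq_peel => u; rewrite /= (negPf j0) mulrC.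
by rewrite peel_column (negPf v0) !mulr0.
Qed.

(** Peeling is unitriangular with respect to size, la being its own strip with coefficient 1. Hence
    a letter can be cancelled from an identity. *)
Lemma peel_inj x (phi psi : seq nat -> R) d :
  (forall la, is_partition la -> (sumn la <= d)%N -> peel x phi la = peel x psi la) ->
  forall la, is_partition la -> (sumn la <= d)%N -> phi la = psi la.
Proof.
move=> h la; elim/ltn_ind: {la}(sumn la) {-2}la (erefl (sumn la)) => k IHk la ek pla lad.
have := h la pla lad.
rewrite /peel !(bigD1_seq la) ?hstrips_refl ?hstrips_uniq //= subnn !mul1r.
set a := \sum_(_ <- _ | _) _; set b := \sum_(_ <- _ | _) _.
suff -> : a = b by move/addIr.
rewrite /a /b big_seq_cond [RHS]big_seq_cond; apply: eq_bigr => mu /andP[hmu ne].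
have lt : (sumn mu < k)%N.
  rewrite -ek ltn_neqAle hstrips_sumn // andbT.
  by apply: contraNneq ne => /hstrips_full ->.
by rewrite (IHk _ lt mu) ?(hstrips_partition hmu) // (leq_trans (ltnW lt)) // -ek.
Qed.

End Hooks.

Definition is_hook r la :=
  if la is _ :: v then all (leq^~ 1%N) v && (sumn v == r) else false.

Lemma is_partition_nseq k a : is_partition (nseq k a).
Proof. by case: k => //=; elim=> //= k IHk; rewrite leqnn. Qed.

Lemma is_partition_hook a r : (0 < a)%N -> is_partition (a :: nseq r 1%N).
Proof.
by case: r => //= r a0; apply/andP; split=> //; apply: (is_partition_nseq r.+1 1%N).
Qed.

Lemma hook_partitions d r : (r < d)%N ->
  (d - r)%N :: nseq r 1%N \in partitions d.
Proof.
move=> rd; rewrite mem_partitions is_partition_hook ?subn_gt0 //=.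
rewrite inE mem_nseq andbF orbF eq_sym -lt0n subn_gt0 rd /=.
by rewrite sumn_nseq mul1n subnK // ltnW.
Qed.

Lemma is_hookE d r la : la \in partitions d ->
  is_hook r la -> la = (d - r)%N :: nseq r 1%N.
Proof.
rewrite mem_partitions => /and3P[_]; case: la => // a v; rewrite inE negb_or /=.
case/andP=> _ v0 /eqP <- /andP[/allP v1 /eqP <-]; rewrite addnK; congr (_ :: _).
have ev : v = nseq (size v) 1%N.
  apply/all_pred1P/allP => x xv; rewrite /= eqn_leq v1 // lt0n.
  by apply: contraNneq v0 => <-.
by have -> : sumn v = size v by rewrite ev sumn_nseq mul1n size_nseq.
Qed.

Lemma plethysm_hook_coef m nu d c r : is_partition nu -> (0 < m)%N ->
  d = (m * sumn nu)%N -> schur_expansion d (schur_h nu m) c ->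
  (r < d)%N ->
  c ((d - r)%N :: nseq r 1%N) =
  (is_hook r nu)%:R.
Proof.
move=> pnu m0 ed hc rd.
(* The order d + 1 exceeds the degree of every evaluation below, as [peels_roots] requires. *)
have [z0 z0prim] := C_prim_root_exists (ltn0Sn d).
pose z : {poly algC} := z0%:P.
have zp : z ^+ d.+1 = 1 by rewrite -rmorphXn /= (prim_expr_order z0prim).
have z_neq1 i : (0 < i <= d)%N -> z ^+ i != 1.
  case/andP=> i0 id; rewrite -rmorphXn /= -polyC1 (inj_eq (@polyC_inj _)).
  by rewrite -(prim_order_dvd z0prim) gtnNdvd.
pose t : {poly algC} := 'X.
pose L := 1 :: [seq - t * z ^+ i | i <- iota 1 d].
have key la k : is_partition la -> (0 < k)%N -> (k * sumn la <= d)%N ->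
    schur_eval la (hlist k L) = super_eval t la.
  move=> pla k0 kd; apply: (@peel_inj _ (- t) _ _ (sumn la)) pla (leqnn _) => mu pmu mud.
  rewrite peel_super_eval // (peel_hlist_roots zp z_neq1) //.
  by apply: leq_trans kd; rewrite leq_mul2l mud orbT.
pose leg la : {poly algC} :=
  if la is a :: v then (all (leq^~ 1%N) v)%:R * t ^+ sumn v else 0.
have superE la : is_partition la -> (0 < sumn la)%N ->
    super_eval t la = leg la * (1 + t).
  case: la => // a v pav; rewrite /super_eval; case: eqP => // a0.
  by rewrite (partition_head0 pav a0).
have legE la : (leg la)`_r = (is_hook r la)%:R.
  case: la => [|a v] /=; first by rewrite coef0.
  rewrite mulr_natl coefMn coefXn eq_sym.
  by case: (all _ _); case: (_ == _).
have d0 : (0 < d)%N by apply: leq_ltn_trans rd.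
(* [key] is applied with k = m to the plethysm and, below, with k = 1 to each Schur function of the
   expansion. *)
have := schur_expansion_eval L hc; rewrite key // -?ed //.
under eq_big_seq => la hla.
  rewrite -(perm_schur_eval _ (perm_hlist1 L)) key ?(partition_mem hla) //; last first.
    by rewrite mul1n; move: hla; rewrite mem_partitions => /and3P[_ _ /eqP ->].
  over.
rewrite superE // => [|]; last by move: d0; rewrite ed muln_gt0 => /andP[].
under eq_big_seq => la hla.
  rewrite superE ?(partition_mem hla) //; last first.
    by move: hla; rewrite mem_partitions => /and3P[_ _ /eqP ->].
  rewrite mulrA; over.
rewrite -big_distrl /= => /mulIf; have t1 : 1 + t != 0.
  by rewrite addrC -[1]polyC1 monic_neq0 // monicXaddC.
move=> /(_ t1) /(congr1 (fun q : {poly algC} => q`_r)); rewrite legE coef_sum.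
under eq_bigr => la _ do rewrite mulrzl coefMrz legE.
rewrite (bigD1_seq _ (hook_partitions rd)) ?partitions_uniq //=.
rewrite big_seq_cond big1 => [|la /andP[hla ne]]; last first.
  case h: (is_hook r la); last by rewrite mul0rz.
  by rewrite (is_hookE hla h) eqxx in ne.
rewrite addr0 sumn_nseq mul1n eqxx (_ : all _ _ = true); last first.
  by apply/allP => x /nseqP[->].
by move=> e; apply: (@intr_inj algC); rewrite -[LHS]e natz.
Qed.

(** * Two-row coefficients: the alphabet {1, X} *)

Fixpoint subsets (T : Type) (L : seq T) (k : nat) : seq (seq T) :=
  match L, k with
  | _, 0 => [:: [::]]
  | [::], _.+1 => [::]
  | x :: L', k'.+1 => subsets L' k'.+1 ++ [seq x :: s | s <- subsets L' k']
  end.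

Lemma subsets0 (T : Type) (L : seq T) : subsets L 0 = [:: [::]].
Proof. by case: L. Qed.

Section HookPieri.

Variable R : comNzRingType.
Implicit Types (x : R) (L : seq R).

Local Notation h k L := (schur_eval [:: k] L).
Local Notation e k L := (schur_eval (nseq k 1%N) L).
Local Notation H j k L := (schur_eval (j.+1 :: nseq k 1%N) L).

Lemma schur_eval_nil L : schur_eval [::] L = 1.
Proof. by elim: L => // x L IHL; rewrite schur_eval_cons peel_nil. Qed.

Lemma schur_eval_row0 L : h 0 L = 1.
Proof. by rewrite -(schur_eval_nil L) -(schur_eval_rcons0 [::]). Qed.

Lemma peel_column1 x (phi : seq nat -> R) k :
  peel x phi (nseq k.+1 1%N) =
  phi (nseq k.+1 1%N) + x * phi (rcons (nseq k 1%N) 0%N).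
Proof.
elim: k phi => [|k IHk] phi.
  rewrite /= peel_cons big_nat_recl // big_nat1 /= !peel_nil subn0 subnn.
  by rewrite mul1r expr1 addrC.
rewrite [nseq _ _]/= peel_cons big_mkcond big_nat_recl // big_nat1 /= add0r mul1r.
exact: IHk.
Qed.

Lemma schur_eval_column_cons k x L : e k.+1 (x :: L) = e k.+1 L + x * e k L.
Proof. by rewrite schur_eval_cons peel_column1 schur_eval_rcons0. Qed.

Lemma schur_eval_column k L : e k L = \sum_(s <- subsets L k) \prod_(x <- s) x.
Proof.
elim: L k => [|x L IHL] [|k].
- by rewrite subsets0 big_seq1 big_nil schur_eval_nil.
- by rewrite big_nil /schur_eval /= /delta_empty.
- by rewrite subsets0 big_seq1 big_nil schur_eval_nil.
rewrite schur_eval_column_cons !IHL big_cat big_map big_distrr; congr (_ + _).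
by apply: eq_bigr => s _; rewrite big_cons.
Qed.

(** Cases on the largest letter x: it ends the arm, it is absent, or it occurs only at the foot of
    the leg. *)
Lemma schur_eval_hook_cons j k x L :
  H j.+1 k.+1 (x :: L) = x * H j k.+1 (x :: L) + H j.+1 k.+1 L + x * H j.+1 k L.
Proof.
rewrite !schur_eval_cons !peel_cons big_mkcond [X in _ = x * X + _ + _]big_mkcond.
rewrite big_nat_recr //= subnn mul1r -[1%N :: nseq k 1%N]/(nseq k.+1 1%N).
rewrite peel_column1 -!rcons_cons schur_eval_rcons0 addrA; congr (_ + _ + _).
rewrite big_distrr /= big_nat [RHS]big_nat; apply: eq_bigr => i hi.
case: ifP => _; last by rewrite mulr0.
by rewrite mulrA -exprS; congr (_ ^+ _ * _); lia.
Qed.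

(** If the smallest letter x occurs, it is the corner, the arm is any multiset from x :: L and the
    leg any subset of L. The Pieri rule for L is a hypothesis so that [hook_pieri] can use this in
    its induction on the alphabet. *)
Lemma schur_eval_hook_of_pieri L :
  (forall a b, h a.+1 L * e b.+1 L = H a b.+1 L + H a.+1 b L) ->
  forall x a b, H a b (x :: L) = x * h a (x :: L) * e b L + H a b L.
Proof.
move=> pieri x; elim=> [|a IHa] [|b].
- by rewrite [nseq 0 _]/= schur_eval_row_cons !schur_eval_row0 schur_eval_nil; ring.
- rewrite -[1%N :: nseq b.+1 1%N]/(nseq b.+2 1%N) schur_eval_column_cons.
  by rewrite schur_eval_row0; ring.
- by rewrite [nseq 0 _]/= schur_eval_row_cons schur_eval_nil; ring.
by rewrite schur_eval_hook_cons IHa schur_eval_row_cons; ring: (pieri a b).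
Qed.

Lemma hook_pieri L a b : h a.+1 L * e b.+1 L = H a b.+1 L + H a.+1 b L.
Proof.
elim: L a b => [|x L IHL] a b.
  by rewrite /schur_eval /= /delta_empty /= mul0r addr0.
rewrite schur_eval_column_cons (schur_eval_hook_of_pieri IHL x a b.+1).
rewrite (schur_eval_hook_of_pieri IHL x a.+1 b).
by rewrite schur_eval_row_cons; ring: (IHL a b).
Qed.

(* The letter x is read as the smallest one. *)
Lemma schur_eval_hook x L a b :
  H a b (x :: L) = x * h a (x :: L) * e b L + H a b L.
Proof. exact/schur_eval_hook_of_pieri/hook_pieri. Qed.

Lemma peel_scale y x (phi : seq nat -> R) la :
  peel (y * x) (fun mu => y ^+ sumn mu * phi mu) la = y ^+ sumn la * peel x phi la.
Proof.
rewrite /peel big_distrr /= !big_seq; apply: eq_bigr => mu hmu.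
by rewrite exprMn -{3}(subnK (hstrips_sumn hmu)) exprD; ring.
Qed.

Lemma schur_eval_scale y la L :
  schur_eval la [seq y * x | x <- L] = y ^+ sumn la * schur_eval la L.
Proof.
elim: L la => [|x L IHL] la /=.
  rewrite /schur_eval /= /delta_empty; case: eqP => [->|_]; last by rewrite mulr0.
  by rewrite mulr1.
by rewrite -peel_scale; apply: eq_peel => mu; apply: IHL.
Qed.

(** For a > 0, removing 1 or y from the alphabet of h_a(1, y, L) leaves an error of that letter
    times h_(a-1)(1, y, L); the two errors cancel after weighting by y and 1. *)
Lemma row_diff y L a :
  (1 - y) * h a [:: 1, y & L] = h a (1 :: L) - y * h a (y :: L).
Proof.
case: a => [|a]; first by rewrite !schur_eval_row0; ring.
have e1 := schur_eval_row_cons a 1 (y :: L).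
have e2 := schur_eval_row_cons a y (1 :: L).
have sw k : h k [:: y, 1 & L] = h k [:: 1, y & L].
  exact/perm_schur_eval/permEl/(perm_catCA [:: y] [:: 1] L).
by rewrite mulrBl mul1r {2}e1 -sw e2 sw; ring.
Qed.

End HookPieri.

Lemma schur_eval_1 (R : comNzRingType) a v : is_partition (a :: v) ->
  schur_eval (a :: v) [:: 1 : R] = (sumn v == 0%N)%:R.
Proof. by move=> pav; rewrite schur_eval_cons peel_delta // expr1n mulr1. Qed.

(** Two letters fill at most two rows, and s_(a,b) is the geometric sum of y^b, .., y^a. *)
Lemma schur_eval_y1 (R : comNzRingType) (y : R) a b w : is_partition [:: a, b & w] ->
  (1 - y) * schur_eval [:: a, b & w] [:: y; 1] =
  (sumn w == 0%N)%:R * (y ^+ b - y ^+ a.+1).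
Proof.
case/andP=> ba pbw; rewrite schur_eval_cons peel_cons [head _ _]/=.
have -> : \sum_(0 <= j < a.+1 | (b <= j)%N)
     y ^+ (a - j) * peel y (fun u => schur_eval (j :: u) [:: 1]) (b :: w) =
   \sum_(0 <= j < a.+1 | (b <= j)%N) y ^+ (a - j) * ((sumn w == 0%N)%:R * y ^+ b).
  apply: eq_bigr => j bj; congr (_ * _); rewrite -peel_delta //.
  apply: eq_in_peel => -[|i u]; rewrite ?nil_hstrips // => hu.
  rewrite schur_eval_1 //=; have := hstrips_partition hu => /= ->.
  by move: hu; rewrite hstrips_cons andbT => /andP[/andP[_ ib] _]; apply: leq_trans bj.
rewrite -big_distrl /= !mulrA -(subnKC ba); set k := (a - b)%N.
have -> : (1 - y) * \sum_(0 <= j < (b + k).+1 | (b <= j)%N) y ^+ (b + k - j) =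
          1 - y ^+ k.+1.
  elim: k => [|k IHk].
    rewrite addn0 big_mkcond big_nat_recr //= leqnn subnn big_nat big1 ?add0r ?mulr1 //.
    by move=> j /andP[_ jb]; rewrite leqNgt jb.
  rewrite addnS big_mkcond big_nat_recr //= ltnW ?ltnS ?leq_addr // subnn mulrDr mulr1.
  rewrite (_ : \sum_(0 <= j < _) _ =
               y * \sum_(0 <= j < (b + k).+1 | (b <= j)%N) y ^+ (b + k - j)).
    by rewrite mulrCA IHk [y ^+ k.+2]exprS; ring.
  rewrite [in RHS]big_mkcond big_distrr /= !big_nat; apply: eq_bigr => j hj.
  case: ifP => _; last by rewrite mulr0.
  by rewrite -exprS; congr (_ ^+ _); lia.
by rewrite -addnS exprD; ring.
Qed.

(** Since a >= b and a + b = d >= 2 r, the negative term X^(a+1) lies above degree r, so only X^b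
    can contribute. *)
Lemma coef_schur_eval_X1 d r la : (0 < d)%N -> (r.*2 <= d)%N -> la \in partitions d ->
  ((1 - 'X) * schur_eval la [:: 'X; 1] : {poly int})`_r = (la == strip [:: d - r; r]%N)%:R.
Proof.
move=> d0 rd; rewrite mem_partitions => /and3P[].
have rd' : (r < d)%N by lia.
have -> : strip [:: d - r; r]%N = if (0 < r)%N then [:: d - r; r]%N else [:: d].
  by rewrite /strip /= subn_gt0 rd'; case: r rd {rd'} => //= rd; rewrite subn0.
case: la => [|a [|b w]] pla.
- by move=> _ /eqP /=; lia.
- move=> _; rewrite [sumn _]/= addn0 => /eqP ->.
  rewrite -(schur_eval_rcons0 [:: d]) schur_eval_y1 //= mul1r coefB !coefXn.
  rewrite (@ltn_eqF r d.+1) ?subr0; last by lia.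
  by case: r {rd rd'} => [|r]; rewrite ?eqxx // eqseq_cons andbF.
rewrite !inE !negb_or => /and3P[a0 b0 w0] /eqP /= sab.
have ab : (b <= a)%N by case/andP: pla.
rewrite schur_eval_y1 // mulr_natl coefMn coefB !coefXn.
have [sw0|sw0] := eqVneq (sumn w) 0%N; last first.
  rewrite mulr0n; case: ifP => _; last by rewrite !eqseq_cons /= andbF.
  by rewrite !eqseq_cons; case: (w) sw0 => //= *; rewrite !andbF.
have -> : w = [::].
  case: (w) w0 sw0 => //= x w'; rewrite inE negb_or => /andP[x0 _] /eqP.
  by rewrite addn_eq0 eq_sym (negPf x0).
rewrite (@ltn_eqF r a.+1) ?subr0; last by lia.
rewrite mulr1n; case: r rd rd' => [|r] rd rd' /=.
  by rewrite (negPf b0) eqseq_cons andbF.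
rewrite !eqseq_cons andbT; congr (nat_of_bool _)%:R.
by apply/eqP/andP => [|[_ /eqP]]; [move=> e; split; apply/eqP; lia | lia].
Qed.

Lemma two_row_coef nu m d c r : (0 < d)%N -> (r.*2 <= d)%N ->
  schur_expansion d (schur_h nu m) c ->
  c (strip [:: d - r; r]%N) =
  ((1 - 'X) * schur_eval nu (hlist m [:: 'X; 1]) : {poly int})`_r.
Proof.
move=> d0 rd hc; rewrite (schur_expansion_eval [:: 'X; 1] hc) big_distrr /= coef_sum.
under eq_big_seq => la hla.
  rewrite mulrCA mulrzl coefMrz (coef_schur_eval_X1 d0 rd hla); over.
have hs : strip [:: d - r; r]%N \in partitions d.
  rewrite mem_partitions strip_partition; last by rewrite /is_partition /= andbT; lia.
  rewrite mem_filter ltnn sumn_strip /=; apply/eqP; lia.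
rewrite (bigD1_seq _ hs) ?partitions_uniq //= eqxx big1 ?addr0 => [|la].
  by rewrite intz.
by move=> /negPf ->; rewrite mul0rz.
Qed.

Lemma perm_hlist_X1 (R : comNzRingType) (y : R) m :
  perm_eq (hlist m [:: y; 1]) (1 :: [seq y ^+ i | i <- iota 1 m]).
Proof.
have e1 k : hlist k [:: y] = [:: y ^+ k].
  by elim: k => [|k IHk]; rewrite ?hlist0 // hlistS IHk exprS.
have -> : 1 :: [seq y ^+ i | i <- iota 1 m] = [seq y ^+ i | i <- iota 0 m.+1].
  by rewrite /= expr0.
apply: perm_trans (perm_hlist m (permEl (perm_catC [:: y] [:: 1]))) _.
elim: m => [|m IHm]; first by rewrite hlist0.
rewrite hlistS e1 (eq_map (g := id)) ?map_id => [|x]; last by rewrite mul1r.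
rewrite -[X in iota 0 X]addn1 iotaD map_cat perm_sym perm_catC /= perm_cons perm_sym.
exact: IHm.
Qed.

Lemma coef_XnM_lt (p : {poly int}) k r : (r < k)%N -> ('X^k * p)`_r = 0.
Proof. by move=> rk; rewrite coefXnM rk. Qed.

(* Modulo X^(a + b + 1) only the tableaux whose corner is 0 contribute, and    *)
(* multiplication by 1 - X forbids the letter 1 in the arm.                    *)
Lemma coef_hook a b m r : (r <= a + b)%N -> (0 < m)%N ->
  ((1 - 'X) * schur_eval (a.+1 :: nseq b 1%N) (hlist m [:: 'X; 1]) : {poly int})`_r =
  (schur_eval [:: a] (1 :: [seq 'X^i | i <- iota 2 m.-1]) *
   schur_eval (nseq b 1%N) [seq 'X^i | i <- iota 1 m] : {poly int})`_r.
Proof.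
case: m => // m rab _; rewrite (perm_schur_eval _ (perm_hlist_X1 _ _)).
set L := [seq 'X^i | i <- iota 1 m.+1]; set L2 := [seq 'X^i | i <- iota 2 m].
have LE : L = 'X :: L2 by rewrite /L /= expr1.
have scale la : exists q : {poly int}, schur_eval la L = 'X^(sumn la) * q.
  exists (schur_eval la [seq 'X^i | i <- iota 0 m.+1]); rewrite -schur_eval_scale.
  congr schur_eval; rewrite /L (iotaDl 1 0) -!map_comp; apply: eq_map => i /=.
  by rewrite exprS.
rewrite schur_eval_hook mul1r mulrDr mulrA {1}LE row_diff -LE mulrBl.
(* All letters of L are multiples of X, so the hooks without the letter 1 and the subtracted term of
   [row_diff] are multiples of X^(a+b+1), beyond degree r. *)
have [q1 ->] := scale (a.+1 :: nseq b 1%N).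
have [q2 ->] := scale [:: a]; have [q3 q3E] := scale (nseq b 1%N).
rewrite coefD coefB [(1 - 'X) * (_ * q1)]mulrCA [X in _ + X]coef_XnM_lt ?addr0; last first.
  by rewrite /= sumn_nseq mul1n; lia.
rewrite [X in _ - X](_ : _ = 0) ?subr0 //.
rewrite q3E [sumn [:: a]]/= addn0 sumn_nseq mul1n.
have -> : 'X * ('X^a * q2) * ('X^b * q3) = 'X^((a + b).+1) * (q2 * q3).
  by rewrite exprS exprD; ring.
by rewrite coef_XnM_lt.
Qed.

(** * Counting the pairs of partitions *)

Lemma subsets_map (T U : Type) (f : T -> U) L k :
  subsets (map f L) k = map (map f) (subsets L k).
Proof.
elim: L k => [|x L IHL] [|k] //=.
by rewrite map_cat -!map_comp !IHL -!map_comp.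
Qed.

Lemma prod_expX (s : seq nat) : \prod_(i <- s) 'X^i = 'X^(sumn s) :> {poly int}.
Proof. by elim: s => [|i s IHs]; rewrite ?big_nil // big_cons IHs -exprD. Qed.

Section Enumeration.

Variable T : eqType.
Implicit Types (L s : seq T).

Lemma mem_subsets L k s : (s \in subsets L k) = (size s == k) && subseq s L.
Proof.
elim: L k s => [|x L IHL] [|k] s; rewrite ?subsets0 ?inE; try by case: s.
  by case: s => [|y s] //=; rewrite andbF.
rewrite [subsets _ _]/= mem_cat IHL; case: s => [|y s] /=.
  by apply/mapP => -[].
rewrite eqSS; have [->|ne] := eqVneq y x.
  rewrite mem_map => [|? ? [] //]; rewrite IHL.
  case: eqP => //= _; case: (boolP (subseq s L)) => [_|/negPf h]; first by rewrite orbT.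
  by rewrite orbF; apply/negP => /(subseq_trans (subseq_cons s x)); rewrite h.
rewrite orbC (_ : (_ \in map _ _) = false) //.
by apply/mapP => -[s' _ [e _]]; rewrite e eqxx in ne.
Qed.

Lemma subsets_uniq L k : uniq L -> uniq (subsets L k).
Proof.
elim: L k => [|x L IHL] [|k] //= /andP[xL uL].
rewrite cat_uniq IHL // map_inj_uniq ?IHL // => [|? ? [] //]; rewrite andbT.
apply/hasPn => _ /mapP[s _ ->]; rewrite mem_subsets negb_and.
by apply/orP; right; apply: contra xL => /mem_subseq/(_ x); apply; apply: mem_head.
Qed.

Lemma msets_sub L k s : s \in msets L k -> {subset s <= L}.
Proof.
elim: L k s => [|x L IHL]; first by case=> // s; rewrite inE => /eqP -> y.
elim=> [|k IHk] s; first by rewrite msets0 inE => /eqP -> y.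
rewrite msetsS mem_cat => /orP[/IHL h|/mapP[s' /IHk h ->]] y.
  by move=> /h yL; rewrite inE yL orbT.
by rewrite inE => /predU1P[->|/h //]; apply: mem_head.
Qed.

Lemma msets_uniq L k : uniq L -> uniq (msets L k).
Proof.
elim: L k => [|x L IHL]; first by case.
elim=> [|k IHk] // xuL; have /andP[xL uL] := xuL.
rewrite msetsS cat_uniq IHL // map_inj_uniq ?IHk // => [|? ? [] //]; rewrite andbT.
apply/hasPn => _ /mapP[s _ ->]; apply: contra xL => /msets_sub; apply.
exact: mem_head.
Qed.

End Enumeration.

Lemma mem_msets (L : seq nat) k s : sorted gtn L ->
  (s \in msets L k) = [&& size s == k, sorted geq s & all (mem L) s].
Proof.
elim: L k s => [|x L IHL].
  by case=> [|k] [|y s] _; rewrite /= ?in_nil ?andbF.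
elim=> [|k IHk] s sL; first by rewrite msets0 inE; case: s.
have sL' : sorted gtn L by apply: path_sorted sL.
have xL y : y \in L -> (y < x)%N by move: y; apply/allP/(order_path_min gtn_transitive sL).
rewrite msetsS mem_cat IHL //; case: s => [|y s] /=.
  by apply/mapP => -[].
rewrite !eqSS inE; have [->|yx] := eqVneq y x.
  rewrite mem_map => [|? ? [] //]; rewrite IHk //.
  rewrite [x \in L](_ : _ = false) ?andbF /=; last first.
    by apply/negP => /xL; rewrite ltnn.
  rewrite (path_sortedE geq_transitive); case: eqP => //= _.
  case: (sorted geq s); rewrite ?andbF //= andbT.
  case: allP => h /=; rewrite ?andbF // andbT; symmetry; apply/allP => z /h.
  by rewrite inE => /predU1P[-> //=|/xL/ltnW].
rewrite orbC (_ : (_ \in map _ _) = false) /=; last first.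
  by apply/mapP => -[s' _ [e _]]; rewrite e eqxx in yx.
case: eqP => //= _; case ys: (path geq y s) => //=; case yL: (y \in L) => //=.
apply: eq_in_all => z zs; rewrite /= inE; have [ez|] //= := eqVneq z x.
have := allP (order_path_min geq_transitive ys) z zs; rewrite /= ez leqNgt.
by rewrite xL.
Qed.

(* Pairs (gamma, epsilon), epsilon being padded with zeros to a entries. *)
Definition hook_pairs a b m r : seq (seq nat * seq nat) :=
  [seq p <- [seq (g, s) | g <- subsets (rev (iota 1 m)) b,
                          s <- msets (rev (0 :: iota 2 m.-1)%N) a]
     | (sumn p.1 + sumn p.2 == r)%N].

(** Every letter is a power of X, so a product records the sum of its exponents; the letter 1 = X^0
    is the zero padding of epsilon. Reversing the alphabets makes the listed sequences
    decreasing. *)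
Lemma coef_hook_pairs a b m r :
  (schur_eval [:: a] (1 :: [seq 'X^i | i <- iota 2 m.-1]) *
   schur_eval (nseq b 1%N) [seq 'X^i | i <- iota 1 m] : {poly int})`_r =
  (size (hook_pairs a b m r))%:R.
Proof.
have permR l : perm_eq [seq 'X^i : {poly int} | i <- l] [seq 'X^i | i <- rev l].
  by rewrite map_rev perm_sym perm_rev.
rewrite -[1 :: _]/([seq 'X^i | i <- (0 :: iota 2 m.-1)%N]).
rewrite (perm_schur_eval _ (permR (0 :: iota 2 m.-1)%N)).
rewrite (perm_schur_eval _ (permR (iota 1 m))) schur_eval_row schur_eval_column.
rewrite /hlist msets_map subsets_map !big_map mulrC big_distrl coef_sum.
rewrite /hook_pairs -sum1_size big_filter [in RHS]big_mkcond big_allpairs_dep natr_sum.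
apply: eq_bigr => g _; rewrite big_distrr coef_sum natr_sum; apply: eq_bigr => s _ /=.
by rewrite !big_map !prod_expX -exprD coefXn eq_sym; case: eqP.
Qed.

Lemma sorted_gtn_rev_iota i m : sorted gtn (rev (iota i m)).
Proof. by rewrite rev_sorted; apply: iota_ltn_sorted. Qed.

Lemma sorted_gtn_subseq (s L : seq nat) :
  sorted gtn s -> sorted gtn L -> {subset s <= L} -> subseq s L.
Proof.
move=> ss sL sub; have uL : uniq L.
  by apply: sorted_uniq sL; [exact: gtn_transitive | exact: ltnn].
apply/subseq_uniqP => //; apply: (irr_sorted_eq gtn_transitive) => //.
- exact: ltnn.
- by apply: sorted_filter => //; exact: gtn_transitive.
by move=> x; rewrite mem_filter /=; case xs: (x \in s) => //=; rewrite sub.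
Qed.

Lemma leq_size_sumn c (s : seq nat) : all (leq c) s -> (c * size s <= sumn s)%N.
Proof.
elim: s => [|x s IHs] /=; rewrite ?muln0 // => /andP[cx /IHs].
by rewrite mulnS; apply: leq_add.
Qed.

Lemma leq_mem_sumn x (s : seq nat) : all (leq 1) s -> x \in s ->
  (x + (size s).-1 <= sumn s)%N.
Proof.
elim: s => //= y s IHs /andP[y1 s1]; rewrite inE => /predU1P[->|xs].
  by rewrite leq_add2l -[size s]mul1n leq_size_sumn.
have := IHs s1 xs; case: s xs {IHs s1} => //= z s _; lia.
Qed.

(** The bijection strips the padding of epsilon. Conversely all bounds hold automatically: gamma
    uses up at least b, so epsilon has at most (r - b) / 2 <= a parts, each at most r - b < m; a
    part of gamma leaves b - 1 positive parts, so it is at most r - b + 1 <= m. *)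
Lemma size_hook_pairs a b m r : (r <= a + b)%N -> (r < m + b)%N ->
  size (hook_pairs a b m r) = size (MPstar b r).
Proof.
move=> rab rmb.
have sI2 : sorted gtn (rev (0 :: iota 2 m.-1)%N).
  rewrite rev_sorted /= path_min_sorted ?iota_ltn_sorted //.
  by apply/allP => x; rewrite mem_iota; lia.
have memP g s : (g, s) \in hook_pairs a b m r ->
   [/\ size g = b /\ subseq g (rev (iota 1 m)), size s = a /\ sorted geq s,
       all (mem (rev (0 :: iota 2 m.-1)%N)) s & (sumn g + sumn s = r)%N].
  rewrite mem_filter => /andP[/eqP <-] /allpairsP[[g' s'] /= []].
  by rewrite mem_subsets mem_msets // => /andP[/eqP ? ?] /and3P[/eqP ? ? ?] [-> ->].
rewrite -(size_map (fun p => (p.1, strip p.2))); apply/perm_size/uniq_perm.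
- rewrite map_inj_in_uniq => [|[g s] [g' s']].
    rewrite filter_uniq // allpairs_uniq ?subsets_uniq ?msets_uniq ?rev_uniq ?iota_uniq //=.
      by rewrite iota_uniq andbT mem_iota.
    by move=> [? ?] [? ?].
  move=> /memP[_ [sz ss] _ _] /memP[_ [sz' ss'] _ _] [-> e].
  by rewrite (strip_pad ss) (strip_pad ss') e sz sz'.
- exact: MPstar_uniq.
move=> [g e]; rewrite mem_MPstar; apply/mapP/idP => [[[g' s] /memP[]]|].
  case=> szg sub [sz ss] /allP hs sr [-> ->].
  have sg : sorted gtn g'.
    by apply: (subseq_sorted gtn_transitive sub); apply: sorted_gtn_rev_iota.
  apply/and5P; split; last (apply/and4P; split).
  - by apply: (sub_sorted _ sg) => x y /= /ltnW.
  - by apply/negP => /(mem_subseq sub); rewrite mem_rev mem_iota.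
  - exact: strip_partition.
  - by rewrite mem_filter.
  - by rewrite sumn_strip sr.
  - by rewrite szg.
  - by apply: sorted_uniq sg; [exact: gtn_transitive | exact: ltnn].
  apply/allP => x; rewrite mem_filter => /andP[x0 /hs /=].
  by rewrite mem_rev inE mem_iota; lia.
case/and5P=> pg g0 pe e0 /and4P[/eqP sr /eqP szg ug /allP e2].
have g1 : all (leq 1) g by apply/allP => x xg; rewrite lt0n; apply: contraNneq g0 => <-.
have le2 := leq_size_sumn (introT allP e2); have := leq_size_sumn g1.
rewrite mul1n szg => bg.
have sze : (size e <= a)%N by move: le2 bg sr rab => /=; lia.
exists (g, e ++ nseq (a - size e) 0%N); last first.
  rewrite /= /strip filter_cat (all_filterP _); last first.
    by apply/allP => x /e2 /ltnW.
  by rewrite (_ : [seq i <- nseq _ 0 | 0 < i]%N = [::]) ?cats0 //; elim: (_ - _)%N.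
rewrite mem_filter /= sumn_cat sumn_nseq mul0n addn0 sr eqxx /=.
apply/allpairsP; exists (g, e ++ nseq (a - size e) 0%N); split=> //=.
  rewrite mem_subsets szg eqxx /=; apply: sorted_gtn_subseq.
  - move: pg ug; rewrite /is_partition sorted_pairwise; last exact: geq_transitive.
    rewrite sorted_pairwise ?uniq_pairwise; last exact: gtn_transitive.
    move=> h1 h2; have := conj h1 h2 => /andP; rewrite -pairwise_relI.
    by apply: sub_pairwise => x y /= /andP[yx ne]; rewrite ltn_neqAle eq_sym ne.
  - exact: sorted_gtn_rev_iota.
  move=> x xg; rewrite mem_rev mem_iota.
  have := leq_mem_sumn g1 xg; have := allP g1 x xg; rewrite szg /=; lia.
rewrite mem_msets // size_cat size_nseq subnKC // eqxx /=; apply/andP; split.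
  rewrite sorted_pairwise; last exact: geq_transitive.
  rewrite pairwise_cat -!sorted_pairwise; try exact: geq_transitive.
  apply/and3P; split=> //; last exact: is_partition_nseq.
  by apply/allrelP => x y _; rewrite mem_nseq => /andP[_ /eqP ->].
rewrite all_cat; apply/andP; split; apply/allP => x.
  move=> xe; rewrite /= mem_rev inE mem_iota; have := mem_le_sumn xe; have := e2 x xe; lia.
by rewrite mem_nseq => /andP[_ /eqP ->]; rewrite /= mem_rev mem_head.
Qed.

Theorem proposition10p14 (m n b r : nat) (hm : (0 < m)%N) (hn : (0 < n)%N)
  (hb : (b < n)%N) (hmr : r%:Z - b%:Z + 1 <= m%:Z)
  (hnr : (r + 1 <= n)%N) :
  (is_partition [:: m * n - r; r]%N ->
     plethysm_coef ((n - b)%N :: nseq b 1%N) [:: m] [:: m * n - r; r]%N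
     = (size (MPstar b r))%:Z)
  /\
  (is_partition ((m * n - r)%N :: nseq r 1%N) ->
     plethysm_coef ((n - b)%N :: nseq b 1%N) [:: m]
       ((m * n - r)%N :: nseq r 1%N)
     = (nat_of_bool (r == b))%:Z).
Proof.
have bn1 : (0 < n - b)%N by rewrite subn_gt0.
set nu := (n - b)%N :: nseq b 1%N.
have pnu : is_partition nu by apply: is_partition_hook.
have nun : sumn nu = n by rewrite /= sumn_nseq mul1n subnK // ltnW.
have d0 : (0 < m * n)%N by rewrite muln_gt0 hm.
have rn : (r < n)%N by rewrite -addn1.
have rd : (r < m * n)%N by apply: leq_trans rn _; rewrite leq_pmull.
pose f := plethysm (schur nu) (schur [:: m]).
(* Existence makes the selected [c] a genuine expansion, and both coefficient lemmas apply to an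
   arbitrary expansion. *)
pose c := epsilon (inhabits (fun=> 0)) (schur_expansion (m * n) f).
have hc : schur_expansion (m * n) (schur_h nu m) c.
  have [c' hc'] := schur_expansion_exists m pnu; rewrite nun in hc'.
  have hf : exists c, schur_expansion (m * n) f c.
    by exists c' => N; rewrite /f plethysmE // -hc'.
  by move=> N; rewrite -(epsilon_spec _ _ hf N) /f plethysmE.
have coefE la : plethysm_coef nu [:: m] la = c (strip la).
  by rewrite /plethysm_coef /schur_coef nun /= addn0 mulnC.
split=> [/= /andP[r2 _]|hpart]; rewrite coefE.
  rewrite (two_row_coef d0 _ hc); last by move: r2 => /=; lia.
  (* With a = n - b - 1 the hypothesis n >= r + 1 reads r <= a + b. *)
  have -> : nu = (n - b).-1.+1 :: nseq b 1%N by rewrite prednK.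
  rewrite coef_hook //; last by lia.
  rewrite coef_hook_pairs size_hook_pairs ?natz //; lia.
rewrite /strip (all_filterP _) => [|]; last first.
  by rewrite /= subn_gt0 rd; apply/allP => x /nseqP[->].
rewrite (plethysm_hook_coef pnu hm _ hc rd); last by rewrite nun.
rewrite natz /is_hook /nu sumn_nseq mul1n eq_sym (_ : all _ _ = true) //.
by apply/allP => x /nseqP[->].
Qed.
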